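(* Let $\Lambda$ and $\Gamma$ be artin algebras and let ${}_{\Lambda}U_{\Gamma}$ be a faithfully balanced selforthogonal bimodule, with ${}_{\Lambda}U$ and $U_{\Gamma}$ finitely generated, which is a Gorenstein bimodule. Suppose that the injective dimension of the right $\Gamma$-module $U_{\Gamma}$ and the injective dimension of the left $\Lambda$-module ${}_{\Lambda}U$ are both equal to a non-negative integer $g$. Let $0\to{}_{\Lambda}U\to E_0\to E_1\to\cdots$ be a minimal injective resolution of ${}_{\Lambda}U$. Then, for any $0\neq M\in\mathrm{mod}\,\Lambda$, the following statements are equivalent. (1) $M\in\mathcal{H}_g(\mathrm{mod}\,\Lambda)$. (2) $M\cong\mathrm{Ext}^g_{\Gamma}(\mathrm{Ext}^g_{\Lambda}(M,U),U)$. (3) $M\cong\mathrm{Ext}^g_{\Gamma}(N,U)$ for some $N\in\mathrm{mod}\,\Gamma^{op}$. (4) $\mathrm{Hom}_{\Lambda}(M,\bigoplus_{i=0}^{g-1}E_i)=0$.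
   Context: $\mathrm{mod}\,\Lambda$ is the category of finitely generated left $\Lambda$-modules and $\mathrm{mod}\,\Gamma^{op}$ the category of finitely generated right $\Gamma$-modules. For $M\in\mathrm{mod}\,\Lambda$, $\mathrm{Ext}^i_{\Lambda}(M,U)$ is a right $\Gamma$-module; for $N\in\mathrm{mod}\,\Gamma^{op}$, $\mathrm{Ext}^i_{\Gamma}(N,U)$ is a left $\Lambda$-module; $\mathrm{Ext}^0=\mathrm{Hom}$. ${}_{\Lambda}U_{\Gamma}$ is faithfully balanced if the natural maps $\Lambda\to\mathrm{End}(U_{\Gamma})$ and $\Gamma\to\mathrm{End}({}_{\Lambda}U)^{op}$ are isomorphisms; it is selforthogonal if $\mathrm{Ext}^i_{\Lambda}({}_{\Lambda}U,{}_{\Lambda}U)=0$ and $\mathrm{Ext}^i_{\Gamma}(U_{\Gamma},U_{\Gamma})=0$ for all $i\geq 1$. For $A$ in $\mathrm{mod}\,\Lambda$ (resp. $\mathrm{mod}\,\Gamma^{op}$): $\mathrm{grade}_U A\geq i$ means $\mathrm{Ext}^j(A,U)=0$ (over $\Lambda$, resp. $\Gamma$) for all $0\leq j<i$; $\mathrm{grade}_U A=g$ means $\mathrm{grade}_U A\ge g$ but not $\mathrm{grade}_U A\ge g+1$; $\mathrm{s.grade}_U A\geq i$ means $\mathrm{grade}_U B\geq i$ for all submodules $B$ of $A$. ${}_{\Lambda}U_{\Gamma}$ is a Gorenstein bimodule if $\mathrm{s.grade}_U\mathrm{Ext}^i_{\Gamma}(N,U)\geq i$ for all $N\in\mathrm{mod}\,\Gamma^{op}$,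 $i\geq 1$, and $\mathrm{s.grade}_U\mathrm{Ext}^i_{\Lambda}(M,U)\geq i$ for all $M\in\mathrm{mod}\,\Lambda$, $i\geq 1$. $\mathcal{H}_g(\mathrm{mod}\,\Lambda)$ is the full subcategory of $\mathrm{mod}\,\Lambda$ consisting of the modules $M$ with $\mathrm{grade}_U M=g$ and $\mathrm{Ext}^i_{\Lambda}(M,U)=0$ for all $i\neq g$. *)

(* Defs.v *)
From HB Require Import structures.
From mathcomp Require Import all_boot all_algebra ring_quotient generic_quotient.
From mathcomp Require Import boolp functions freeg.

Set Implicit Arguments.
Unset Strict Implicit.
Unset Printing Implicit Defensive.
Import GRing.Theory.
Local Open Scope ring_scope.
Local Open Scope quotient_scope.

Definition zero_module (A : nzRingType) (M : lmodType A) : Prop :=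
  forall x : M, x = 0.

Definition fg_module (A : nzRingType) (M : lmodType A) : Prop :=
  exists s : seq M, forall x : M,
    exists c : nat -> A, x = \sum_(i < size s) c i *: s`_i.

Definition iso_module (A : nzRingType) (M N : lmodType A) : Prop :=
  exists f : {linear M -> N}, bijective f.

Record submod (A : nzRingType) (V : lmodType A) := Submod {
  submod_pred :> {pred V};
  submod_closedP : GRing.subsemimod_closed submod_pred }.

Section Submodule.
Variables (A : nzRingType) (V : lmodType A) (S : submod V).

HB.instance Definition _ :=
  GRing.isSubmodClosed.Build A V (submod_pred S) (submod_closedP S).

Definition submod_sort : Type := {x : V | x \in submod_pred S}.

HB.instance Definition _ := SubChoice.on submod_sort.
HB.instance Definition _ :=
  GRing.SubChoice_isSubLmodule.Build A V (submod_pred S) submod_sort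
    (submod_closedP S).

Definition submod_incl : {linear submod_sort -> V} := (\val : submod_sort -> V).

Definition quotm : Type := Quotient.quot (submod_pred S).

HB.instance Definition _ := ZmodQuotient.on quotm.

Definition quotm_scale (a : A) (x : quotm) : quotm := \pi_quotm (a *: repr x).

Lemma quotm_scaleE a (v : V) : quotm_scale a (\pi_quotm v) = \pi_quotm (a *: v).
Proof.
apply/eqP; rewrite -Quotient.idealrBE -scalerBr rpredZ //.
by rewrite Quotient.idealrBE reprK.
Qed.

Lemma quotmD (v w : V) : \pi_quotm (v + w) = \pi_quotm v + \pi_quotm w.
Proof. exact: raddfD. Qed.

Lemma quotm_scaleA a b x :
  quotm_scale a (quotm_scale b x) = quotm_scale (a * b) x.
Proof. by elim/quotW: x => v; rewrite (quotm_scaleE b) !quotm_scaleE scalerA. Qed.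

Lemma quotm_scale1 : left_id 1 quotm_scale.
Proof. by elim/quotW => v; rewrite quotm_scaleE scale1r. Qed.

Lemma quotm_scaleDr : right_distributive quotm_scale +%R.
Proof.
move=> a; elim/quotW => v; elim/quotW => w.
by rewrite -quotmD !quotm_scaleE -quotmD scalerDr.
Qed.

Lemma quotm_scaleDl x : {morph quotm_scale^~ x : a b / a + b}.
Proof. by elim/quotW: x => v a b; rewrite !quotm_scaleE -quotmD scalerDl. Qed.

HB.instance Definition _ := GRing.Zmodule_isLmodule.Build A quotm
  quotm_scaleA quotm_scale1 quotm_scaleDr quotm_scaleDl.

End Submodule.

Section KernelImage.
Variables (A : nzRingType) (V W : lmodType A) (f : {linear V -> W}).

Lemma ker_closed : GRing.subsemimod_closed [pred x | f x == 0].
Proof.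
split; first split; rewrite ?inE ?linear0 //.
  by move=> x y; rewrite !inE => /eqP fx /eqP fy; rewrite linearD /= fx fy addr0.
by move=> a x; rewrite !inE => /eqP fx; rewrite linearZ /= fx scaler0.
Qed.

Definition kerm : submod V := Submod ker_closed.

Lemma im_closed : GRing.subsemimod_closed [pred y | `[< exists x, f x = y >]].
Proof.
split; first split; rewrite ?inE.
- by apply/asboolP; exists 0; rewrite linear0.
- move=> _ _ /asboolP[x <-] /asboolP[y <-].
  by apply/asboolP; exists (x + y); rewrite linearD.
- by move=> a _ /asboolP[x <-]; apply/asboolP; exists (a *: x); rewrite linearZ.
Qed.

Definition imm : submod W := Submod im_closed.

Lemma preim_closed (S : submod W) : GRing.subsemimod_closed [pred x | f x \in S].
Proof.
split; first split; rewrite ?inE ?linear0 ?rpred0 //.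
  by move=> x y; rewrite !inE => Sx Sy; rewrite linearD /= rpredD.
by move=> a x; rewrite !inE => Sx; rewrite linearZ /= rpredZ.
Qed.

Definition preimm (S : submod W) : submod V := Submod (preim_closed S).

End KernelImage.

Definition homology (A : nzRingType) (X Y Z : lmodType A)
    (f : {linear X -> Y}) (g : {linear Y -> Z}) : lmodType A :=
  quotm (preimm (submod_incl (kerm g)) (imm f)).

(* The functorial free resolution of M, total in M: each syzygy is covered by
   the free module on its underlying set, a formal sum being sent to its value. *)
Section FreeResolution.
Variable A : nzRingType.

Section Cover.
Variable M : lmodType A.

Definition free_cover_fun : {freeg M / A} -> M := fglift idfun.

Lemma free_cover_additive : zmod_morphism free_cover_fun.
Proof. exact: lift_is_additive. Qed.

HB.instance Definition _ :=
  GRing.isZmodMorphism.Build {freeg M / A} M free_cover_fun free_cover_additive.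

Lemma free_cover_scalable : scalable free_cover_fun.
Proof.
move=> a D.
have coverE (b : M -> A) : free_cover_fun (\sum_(z <- dom D) << b z *g z >>)
    = \sum_(z <- dom D) b z *: z.
  by rewrite raddf_sum; apply: eq_bigr => z _; exact: liftU.
rewrite -[in RHS](freeg_sumE D) coverE [LHS]coverE scaler_sumr.
by apply: eq_bigr => z _; rewrite scalerA.
Qed.

HB.instance Definition _ :=
  GRing.isScalable.Build A {freeg M / A} M *:%R free_cover_fun free_cover_scalable.

Definition free_cover : {linear {freeg M / A} -> M} := free_cover_fun.

End Cover.

Fixpoint syz (M : lmodType A) (n : nat) : lmodType A :=
  if n is m.+1 then submod_sort (kerm (free_cover (syz M m))) else M.

Definition res (M : lmodType A) (n : nat) : lmodType A := {freeg (syz M n) / A}.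

Definition res_d (M : lmodType A) (n : nat) : {linear res M n.+1 -> res M n} :=
  submod_incl (kerm (free_cover (syz M n))) \o free_cover (syz M n.+1).

End FreeResolution.

(* An A-module with a commuting left action of B.  A Lambda-Gamma-bimodule
   is a bimod Lambda Gamma^c, right Gamma-modules being left modules over the
   converse ring Gamma^c. *)
Record bimod (A B : nzRingType) := Bimod {
  bimod_lmod :> lmodType A;
  biact : B -> bimod_lmod -> bimod_lmod;
  biactA : forall b c u, biact b (biact c u) = biact (b * c) u;
  biact1 : forall u, biact 1 u = u;
  biactDr : forall b, {morph biact b : u v / u + v};
  biactDl : forall u, {morph biact^~ u : b c / b + c};
  biactZ : forall a b u, biact b (a *: u) = a *: biact b u }.

Section Flip.
Variables (A B : nzRingType) (U : bimod A B).

Definition flip_sort : Type := U.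

HB.instance Definition _ := GRing.Zmodule.on flip_sort.
HB.instance Definition _ := GRing.Zmodule_isLmodule.Build B flip_sort
  (@biactA _ _ U) (@biact1 _ _ U) (@biactDr _ _ U) (@biactDl _ _ U).

Definition flip : bimod B A :=
  @Bimod B A flip_sort (fun a (u : U) => a *: u)
    (@scalerA A U) (@scale1r A U) (@scalerDr A U) (@scalerDl A U)
    (fun b a u => esym (biactZ a b u)).

Lemma biact_additive (b : B) : zmod_morphism (biact b : U -> U).
Proof.
by move=> u v; rewrite -scaleN1r biactDr biactZ scaleN1r.
Qed.

HB.instance Definition _ (b : B) :=
  GRing.isZmodMorphism.Build U U (biact b) (biact_additive b).
HB.instance Definition _ (b : B) :=
  GRing.isScalable.Build A U U *:%R (biact b) (fun a u => biactZ a b u).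

(* The natural map from B to the A-endomorphisms of U. *)
Definition homothety (b : B) : {linear U -> U} := biact b.

End Flip.

Section Hom.
Variables (A B : nzRingType) (U : bimod A B).

Definition Hom (M : lmodType A) : Type := {linear M -> U}.

Section HomModule.
Variable M : lmodType A.
Implicit Types f g h : Hom M.

HB.instance Definition _ := gen_eqMixin (Hom M).
HB.instance Definition _ := gen_choiceMixin (Hom M).

Lemma Hom_eq f g : (forall x : M, f x = g x) -> f = g.
Proof.
case: f g => f [[fD] [fZ]] [g [[gD] [gZ]]] /= fg.
have {}fg : f = g by apply/funext.
by subst g; rewrite (Prop_irrelevance fD gD) (Prop_irrelevance fZ gZ).
Qed.

Definition Hom0 : Hom M := (\0 : M -> U).
Definition HomN f : Hom M := (\- (f : {linear M -> U}) : M -> U).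
Definition HomD f g : Hom M :=
  ((f : {linear M -> U}) \+ (g : {linear M -> U}) : M -> U).
Definition HomZ (b : B) f : Hom M := (homothety U b \o (f : {linear M -> U})).

Lemma HomDA : associative HomD.
Proof. by move=> f g h; apply: Hom_eq => x /=; rewrite addrA. Qed.
Lemma HomDC : commutative HomD.
Proof. by move=> f g; apply: Hom_eq => x /=; rewrite addrC. Qed.
Lemma Hom0D : left_id Hom0 HomD.
Proof. by move=> f; apply: Hom_eq => x /=; rewrite add0r. Qed.
Lemma HomND : left_inverse Hom0 HomN HomD.
Proof. by move=> f; apply: Hom_eq => x /=; rewrite addNr. Qed.

HB.instance Definition _ := GRing.isZmodule.Build (Hom M) HomDA HomDC Hom0D HomND.

Lemma HomZA b c f : HomZ b (HomZ c f) = HomZ (b * c) f.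
Proof. by apply: Hom_eq => x /=; rewrite biactA. Qed.
Lemma Hom1Z : left_id 1 HomZ.
Proof. by move=> f; apply: Hom_eq => x /=; rewrite biact1. Qed.
Lemma HomZDr : right_distributive HomZ +%R.
Proof. by move=> b f g; apply: Hom_eq => x /=; rewrite biactDr. Qed.
Lemma HomZDl f : {morph HomZ^~ f : b c / b + c}.
Proof. by move=> b c; apply: Hom_eq => x /=; rewrite biactDl. Qed.

HB.instance Definition _ :=
  GRing.Zmodule_isLmodule.Build B (Hom M) HomZA Hom1Z HomZDr HomZDl.

End HomModule.

Section Precomposition.
Variables (M N : lmodType A) (d : {linear M -> N}).

Definition precomp_fun (f : Hom N) : Hom M := (f : {linear N -> U}) \o d.

Lemma precomp_additive : zmod_morphism precomp_fun.
Proof. by move=> f g; apply: Hom_eq. Qed.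
Lemma precomp_scalable : scalable precomp_fun.
Proof. by move=> b f; apply: Hom_eq. Qed.

HB.instance Definition _ :=
  GRing.isZmodMorphism.Build (Hom N) (Hom M) precomp_fun precomp_additive.
HB.instance Definition _ :=
  GRing.isScalable.Build B (Hom N) (Hom M) *:%R precomp_fun precomp_scalable.

Definition precomp : {linear Hom N -> Hom M} := precomp_fun.

End Precomposition.

(* Ext^i_A(M, U) as a B-module: degree 0 is Hom itself, higher degrees are the
   cohomology of Hom(-, U) applied to the free resolution res M.  B acts through
   U.  For a Lambda-Gamma-bimodule U, Ext U i M is Ext^i_Lambda(M, U) and
   Ext (flip U) i N is Ext^i_Gamma(N, U). *)
Definition Ext (i : nat) (M : lmodType A) : lmodType B :=
  if i is n.+1 then homology (precomp (res_d M n)) (precomp (res_d M n.+1))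
  else Hom M.

End Hom.

Section BimoduleNotions.
Variables (A B : nzRingType) (U : bimod A B).

Definition faithfully_balanced : Prop :=
  bijective (homothety (flip U)) /\ bijective (homothety U).

Definition selforthogonal : Prop := forall i : nat, (1 <= i)%N ->
  zero_module (Ext U i U) /\ zero_module (Ext (flip U) i (flip U)).

Definition grade_ge (M : lmodType A) (i : nat) : Prop :=
  forall j : nat, (j < i)%N -> zero_module (Ext U j M).

Definition grade_eq (M : lmodType A) (g : nat) : Prop :=
  grade_ge M g /\ ~ grade_ge M g.+1.

Definition sgrade_ge (M : lmodType A) (i : nat) : Prop :=
  forall S : submod M, grade_ge (submod_sort S) i.

Definition in_H (g : nat) (M : lmodType A) : Prop :=
  [/\ fg_module M, grade_eq M g &
      forall i : nat, i <> g -> zero_module (Ext U i M)].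

End BimoduleNotions.

Definition gorenstein_bimodule (A B : nzRingType) (U : bimod A B) : Prop :=
  (forall (N : lmodType B) (i : nat), fg_module N -> (1 <= i)%N ->
     sgrade_ge U (Ext (flip U) i N) i) /\
  (forall (M : lmodType A) (i : nat), fg_module M -> (1 <= i)%N ->
     sgrade_ge (flip U) (Ext U i M) i).

Section Injective.
Variable A : nzRingType.

Definition injective_module (E : lmodType A) : Prop :=
  forall (X Y : lmodType A) (i : {linear X -> Y}) (f : {linear X -> E}),
    injective i -> exists h : {linear Y -> E}, forall x, h (i x) = f x.

Definition injective_resolution (M : lmodType A) (E : nat -> lmodType A)
    (e : {linear M -> E 0%N}) (d : forall n, {linear E n -> E n.+1}) : Prop :=
  [/\ forall n, injective_module (E n),
      injective e,
      forall x, d 0%N x = 0 <-> exists m, e m = x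
    & forall n x, d n.+1 x = 0 <-> exists y, d n y = x].

Definition essential_image (X Y : lmodType A) (f : {linear X -> Y}) : Prop :=
  forall S : submod Y, (exists2 y, y \in S & y != 0) ->
    exists x, f x \in S /\ f x != 0.

(* E n.+1 is an injective envelope of the cokernel preceding it, which d n
   identifies with its image. *)
Definition minimal_injective_resolution (M : lmodType A)
    (E : nat -> lmodType A) (e : {linear M -> E 0%N})
    (d : forall n, {linear E n -> E n.+1}) : Prop :=
  [/\ injective_resolution e d, essential_image e
    & forall n, essential_image (d n)].

Definition injdim_le (M : lmodType A) (n : nat) : Prop :=
  exists (E : nat -> lmodType A) (e : {linear M -> E 0%N})
         (d : forall n, {linear E n -> E n.+1}),
    injective_resolution e d /\ forall m, (n < m)%N -> zero_module (E m).

Definition injdim_eq (M : lmodType A) (n : nat) : Prop :=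
  injdim_le M n /\ forall m : nat, (m < n)%N -> ~ injdim_le M m.

(* The direct sum of E 0, ..., E n.-1; 'rV[A]_0 is the zero module. *)
Fixpoint dsum (E : nat -> lmodType A) (n : nat) : lmodType A :=
  if n is m.+1 then (dsum E m * E m)%type else 'rV[A]_0.

End Injective.

(* Submodules of k^o are the ideals of k. *)
Definition artinian (k : comNzRingType) : Prop :=
  forall I : nat -> submod k^o, (forall n, {subset I n.+1 <= I n}) ->
    exists n, forall m, (n <= m)%N -> I m =i I n.

Definition artin_algebra (k : comNzRingType) (L : algType k) : Prop :=
  artinian k /\ @fg_module k L.

(* Main.v *)
(** Write X^* = Hom(X, U).  If M is finitely generated with Ext^i(M, U) = 0 for all
    i > 0, then, since U_Gamma has finite injective dimension, dimension shifting
    along a free resolution shows that M^* is acyclic for Hom(-, U) and that M = M^**.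
    Suppose only that Ext^i(M, U) = 0 for i <> g, with g > 0.  Then (1) => (2) follows
    by applying this to the g-th syzygy K of M: the complex
    0 -> P_0^* -> ... -> P_(g-1)^* -> K^* is an acyclic resolution of Ext^g(M, U), and
    its dual has homology M in the last degree.

    For (3) => (4), if all submodules of W have grade at least g, then
    Hom(X, E_i) = 0 for i < g and X embedded in W, by induction on i: if f : X -> E_i is
    nonzero then, by minimality, its restriction to the preimage of Ker(E_i -> E_(i+1))
    is nonzero, and Ext^i = 0 makes that restriction factor through E_(i-1) (through U if
    i = 0).  For (4) => (1), Ext^i(M, U) vanishes for i < g by (4) and for i > g by
    the injective dimension; were Ext^g(M, U) zero as well, the argument for (1) => (2)
    would give M = 0.

    Vanishing of Ext is tested on injective resolutions
    ([lifts]), whereas the modules Ext^i are compared as cokernels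
    Hom(F, U) -> Hom(Omega, U) over the free cover ([is_ext1]). *)

Require Import Defs.
From HB Require Import structures.
From mathcomp Require Import all_boot all_algebra ring_quotient generic_quotient.
From mathcomp Require Import boolp freeg.
(* Again: all_algebra has its own [precomp]. *)
Require Import Defs.

Set Implicit Arguments.
Unset Strict Implicit.
Unset Printing Implicit Defensive.
Import GRing.Theory.
Local Open Scope ring_scope.
Local Open Scope quotient_scope.

(** * Linear maps and short exact sequences *)

Section LinearRelations.
Variables (A : nzRingType) (V W : lmodType A).

Section MkLinear.
Variables (f : V -> W) (fL : linear f).
HB.instance Definition _ := GRing.isLinear.Build A V W *:%R f fL.
Definition mklinear : {linear V -> W} := f.
End MkLinear.

Variable R : V -> W -> Prop.
Hypothesis R_total : forall v, exists w, R v w.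
Hypothesis R_lin : forall a v w v' w',
  R v w -> R v' w' -> R (a *: v + v') (a *: w + w').
Hypothesis R_0 : forall w, R 0 w -> w = 0.

Lemma rel_unique v w w' : R v w -> R v w' -> w = w'.
Proof.
move=> vw vw'; apply/eqP; rewrite -subr_eq0 addrC -[- w']scaleN1r; apply/eqP/R_0.
by rewrite -(addNr v) -[- v]scaleN1r; exact: R_lin.
Qed.

(** Maps are given by graphs: [R_0] and linearity make [R] single-valued, so a choice function for
    it is linear. *)
Lemma linear_of_rel : exists f : {linear V -> W}, forall v w, R v w <-> f v = w.
Proof.
have [f fR] := choice R_total.
have fL : linear f.
  by move=> a u v; apply: rel_unique (fR _) _; exact: R_lin.
by exists (mklinear fL) => v w; split=> [vw|<-]; [exact: rel_unique vw | exact: fR].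
Qed.

Lemma iso_of_rel : (forall w, exists v, R v w) -> (forall v, R v 0 -> v = 0) ->
  iso_module V W.
Proof.
move=> R_surj R_inj; have [f fR] := linear_of_rel.
exists f; have [h hR] := choice R_surj.
exists h => [v|w]; last by apply/fR.
apply/eqP; rewrite -subr_eq0; apply/eqP/R_inj/fR.
by have /fR e := hR (f v); rewrite linearB /= e subrr.
Qed.

End LinearRelations.

Section Submodules.
Variables (A : nzRingType) (V : lmodType A).

Lemma submodP (S : submod V) (x : submod_sort S) : submod_incl S x \in S.
Proof. exact: valP. Qed.

Lemma submod_exists (S : submod V) (x : V) : x \in S ->
  exists y : submod_sort S, submod_incl S y = x.
Proof. by move=> Sx; exists (Sub x Sx); exact: (SubK (submod_sort S) Sx). Qed.

Lemma submod_incl_inj (S : submod V) : injective (submod_incl S).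
Proof. exact: val_inj. Qed.

Lemma corestrict (W : lmodType A) (S : submod V) (f : {linear W -> V}) :
  (forall x, f x \in S) ->
  exists h : {linear W -> submod_sort S}, forall x, submod_incl S (h x) = f x.
Proof.
move=> Sf; have [||| h hf] :=
  @linear_of_rel _ W (submod_sort S) (fun x y => submod_incl S y = f x).
- by move=> x; have [y] := submod_exists (Sf x); exists y.
- by move=> a x y x' y' ey ey'; rewrite !linearP ey ey'.
- by move=> y ey; apply: (@submod_incl_inj S); rewrite ey !linear0.
- by exists h => x; apply/hf.
Qed.

Lemma quotient_map (S : submod V) :
  exists p : {linear V -> quotm S},
    (forall y, exists x, p x = y) /\ forall x, p x = 0 <-> x \in S.
Proof.
have piL : linear (\pi_(quotm S) : V -> quotm S).
  move=> a x y; rewrite quotmD; congr (_ + _).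
  by rewrite [RHS](quotm_scaleE S a x).
exists (mklinear piL); split=> [y|x] /=.
  by exists (repr y); rewrite /mklinear /= reprK.
have e0 : mklinear piL 0 = 0 by rewrite linear0.
rewrite -e0 -[X in X \in _]subr0 Quotient.idealrBE.
by split=> [h|/eqP //]; apply/eqP.
Qed.

End Submodules.

Lemma kermP (A : nzRingType) (V W : lmodType A) (f : {linear V -> W}) x :
  x \in kerm f <-> f x = 0.
Proof. by split=> [/eqP|/eqP]. Qed.

Lemma kerm_incl (A : nzRingType) (V W : lmodType A) (f : {linear V -> W}) x :
  (exists y, submod_incl (kerm f) y = x) <-> f x = 0.
Proof.
split=> [[y <-]|fx]; first by apply/kermP; exact: submodP.
by apply: submod_exists; apply/kermP.
Qed.

Lemma immP (A : nzRingType) (V W : lmodType A) (f : {linear V -> W}) y :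
  y \in imm f <-> exists x, f x = y.
Proof. by split=> [/asboolP|/asboolP]. Qed.

Lemma free_cover_basis (A : nzRingType) (M : lmodType A) (x : M) :
  free_cover M << x >> = x.
Proof. by rewrite /free_cover /= /free_cover_fun liftU scale1r. Qed.

Lemma free_cover_surj (A : nzRingType) (M : lmodType A) (x : M) :
  exists y, free_cover M y = x.
Proof. by exists << x >>; exact: free_cover_basis. Qed.

Arguments free_cover : simpl never.
Arguments submod_incl : simpl never.

Section LinearMaps.
Variable A : nzRingType.

Definition surj (V W : lmodType A) (f : {linear V -> W}) :=
  forall y, exists x, f x = y.

Definition ses (K P M : lmodType A) (i : {linear K -> P}) (p : {linear P -> M}) :=
  [/\ injective i, surj p & forall x, p x = 0 <-> exists k, i k = x].

Definition projective (P : lmodType A) :=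
  forall (X Y : lmodType A) (q : {linear X -> Y}) (f : {linear P -> Y}),
    surj q -> exists h : {linear P -> X}, forall x, q (h x) = f x.

Lemma ses_kerm (P M : lmodType A) (p : {linear P -> M}) :
  surj p -> ses (submod_incl (kerm p)) p.
Proof.
by split=> // [|x]; [exact: submod_incl_inj | rewrite -kerm_incl].
Qed.

Lemma factor_surj (P M W : lmodType A) (p : {linear P -> M}) (f : {linear P -> W}) :
  surj p -> (forall x, p x = 0 -> f x = 0) ->
  exists h : {linear M -> W}, forall x, h (p x) = f x.
Proof.
move=> p_surj fp0.
have [||| h hf] := @linear_of_rel _ M W (fun m w => exists2 x, p x = m & f x = w).
- by move=> m; have [x px] := p_surj m; exists (f x), x.
- move=> a m w m' w' [x <- <-] [x' <- <-].
  by exists (a *: x + x'); rewrite linearP.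
- by move=> w [x px <-]; exact: fp0.
- by exists h => x; apply/hf; exists x.
Qed.

Lemma factor_inj (X W I : lmodType A) (e : {linear W -> I}) (f : {linear X -> I}) :
  injective e -> (forall x, exists w, e w = f x) ->
  exists h : {linear X -> W}, forall x, e (h x) = f x.
Proof.
move=> e_inj fe.
have [||| h hf] := @linear_of_rel _ X W (fun x w => e w = f x) => //.
- by move=> a x w x' w' ew ew'; rewrite !linearP ew ew'.
- by move=> w ew; apply: e_inj; rewrite ew !linear0.
- by exists h => x; apply/hf.
Qed.

Lemma pushout_map (F K P W : lmodType A) (a : {linear F -> P}) (i : {linear K -> P})
    (f : {linear F -> W}) (g : {linear K -> W}) :
  (forall y, exists x k, a x + i k = y) ->
  (forall x k, a x + i k = 0 -> f x + g k = 0) ->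
  exists h : {linear P -> W}, (forall x, h (a x) = f x) /\ forall k, h (i k) = g k.
Proof.
move=> ai_surj fg0.
have [||| h hE] := @linear_of_rel _ P W
  (fun y w => exists x k, a x + i k = y /\ f x + g k = w).
- by move=> y; have [x [k xk]] := ai_surj y; exists (f x + g k), x, k.
- move=> b y w y' w' [x [k [<- <-]]] [x' [k' [<- <-]]].
  by exists (b *: x + x'), (b *: k + k'); rewrite !linearP !scalerDr; split; rewrite addrACA.
- by move=> w [x [k [xk <-]]]; exact: fg0.
exists h; split=> z; apply/hE.
  by exists z, 0; rewrite !linear0 !addr0.
by exists 0, z; rewrite !linear0 !add0r.
Qed.

Section Pairs.
Variables X Y Z : lmodType A.

Lemma pair_inl_linear : linear (fun x : X => (x, 0) : (X * Y)%type).
Proof.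
move=> a x x'; rewrite -[RHS]/(a *: x + x', a *: 0 + 0).
by rewrite scaler0 addr0.
Qed.
Definition pair_inl : {linear X -> (X * Y)%type} := mklinear pair_inl_linear.

Lemma pair_inr_linear : linear (fun y : Y => (0, y) : (X * Y)%type).
Proof.
move=> a y y'; rewrite -[RHS]/(a *: 0 + 0, a *: y + y').
by rewrite scaler0 addr0.
Qed.
Definition pair_inr : {linear Y -> (X * Y)%type} := mklinear pair_inr_linear.

Variables (f : {linear X -> Z}) (g : {linear Y -> Z}).

Lemma copair_linear : linear (fun z : X * Y => f z.1 + g z.2).
Proof. by move=> a z z'; rewrite !linearP scalerDr addrACA. Qed.
Definition copair : {linear (X * Y)%type -> Z} := mklinear copair_linear.

Lemma copairE x y : copair (x, y) = f x + g y.
Proof. by []. Qed.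

End Pairs.

Section FreeLift.
Variables (M X : lmodType A) (c : M -> X).

Definition free_lift_fun : {freeg M / A} -> X := fglift c.

Lemma free_lift_additive : zmod_morphism free_lift_fun.
Proof. exact: lift_is_additive. Qed.

HB.instance Definition _ :=
  GRing.isZmodMorphism.Build {freeg M / A} X free_lift_fun free_lift_additive.

Lemma free_lift_scalable : scalable free_lift_fun.
Proof.
move=> a D.
have liftE (b : M -> A) : free_lift_fun (\sum_(z <- dom D) << b z *g z >>)
    = \sum_(z <- dom D) b z *: c z.
  by rewrite raddf_sum; apply: eq_bigr => z _; exact: liftU.
rewrite -[in RHS](freeg_sumE D) liftE [LHS]liftE scaler_sumr.
by apply: eq_bigr => z _; rewrite scalerA.
Qed.

HB.instance Definition _ :=
  GRing.isScalable.Build A {freeg M / A} X *:%R free_lift_fun free_lift_scalable.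

Definition free_lift : {linear {freeg M / A} -> X} := free_lift_fun.

Lemma free_lift_basis x : free_lift << x >> = c x.
Proof. by rewrite /free_lift /= /free_lift_fun liftU scale1r. Qed.

End FreeLift.

Lemma free_ext (M X : lmodType A) (f h : {linear {freeg M / A} -> X}) :
  (forall x : M, f << x >> = h << x >>) -> forall D, f D = h D.
Proof.
move=> fh D; rewrite -(freeg_sumE D) !linear_sum; apply: eq_bigr => z _.
have -> : << coeff z D *g z >> = coeff z D *: << z >> :> {freeg M / A}.
  by apply/eqP/freeg_eqP => y; rewrite coeffZ !coeffU mul1r.
by rewrite !linearZ fh.
Qed.

Lemma free_projective (M : lmodType A) : projective {freeg M / A}.
Proof.
move=> X Y q f q_surj.
have [c qc] := choice (fun x : M => q_surj (f << x >>)).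
exists (free_lift c) => D.
apply: (free_ext (f := q \o free_lift c)) => x.
exact: etrans (congr1 q (free_lift_basis c x)) (qc x).
Qed.

End LinearMaps.

(** * Vanishing of the first extension group *)

Section Vanishing.
Variables (A : nzRingType).

Definition syz_incl (M : lmodType A) : {linear syz M 1 -> {freeg M / A}} :=
  submod_incl (kerm (free_cover M)).

Lemma syz_inclP (M : lmodType A) : ses (syz_incl M) (free_cover M).
Proof. exact/ses_kerm/free_cover_surj. Qed.

Lemma free_cover_syz (M : lmodType A) x : free_cover M (syz_incl M x) = 0.
Proof. by have [_ _ ->] := syz_inclP M; exists x. Qed.

(* Vanishing of [Ext^1(X, W)]. *)
Definition ext0 (X W : lmodType A) := forall f : {linear syz X 1 -> W},
  exists h : {linear {freeg X / A} -> W}, forall x, h (syz_incl X x) = f x.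

Section Shift.
Variables (W I W' : lmodType A) (e : {linear W -> I}) (p : {linear I -> W'}).
Hypotheses (ep : ses e p) (I_inj : injective_module I).

(** Lift, then correct: a lift to [I] of [f] on the free cover maps the syzygy into [W]; extending
    that map to the cover and subtracting lets the lift descend to [X]. Conversely, extend into [I]
    and correct by a lift. *)
Lemma ext0_lift X : ext0 X W <->
  forall f : {linear X -> W'}, exists h : {linear X -> I}, forall x, p (h x) = f x.
Proof.
have [e_inj p_surj p_ker] := ep.
have [i_inj c_surj c_ker] := syz_inclP X.
set i := syz_incl X in i_inj c_surj c_ker *.
split=> [XW f|XI f].
- have [h hE] := free_projective (f \o free_cover X) p_surj.
  have [||r rE] := factor_inj (e := e) (f := h \o i) => //.
    move=> x; apply/p_ker; rewrite /= hE /=.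
    by rewrite free_cover_syz linear0.
  have [s sE] := XW r.
  have [||t tE] := factor_surj (p := free_cover X) (f := h \- (e \o s)) => //.
    by move=> x /c_ker[y <-] /=; rewrite [s _]sE rE subrr.
  exists t => x; have [y <-] := c_surj x.
  rewrite tE /= linearB /= hE (_ : p (e _) = 0) ?subr0 //.
  by apply/p_ker; exists (s y).
- have [h hE] := I_inj (e \o f) i_inj.
  have [||r rE] := factor_surj (p := free_cover X) (f := p \o h) => //.
    by move=> x /c_ker[y <-] /=; rewrite hE; apply/p_ker; exists (f y).
  have [s sE] := XI r.
  have [||t tE] := factor_inj (e := e) (f := h \- (s \o free_cover X)) => //.
    by move=> x; apply/p_ker; rewrite /= linearB /= sE rE subrr.
  exists t => x; apply: e_inj; rewrite tE /= hE /=.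
  by rewrite free_cover_syz linear0 subr0.
Qed.

(** Both sides express the vanishing of Ext^2(X, W). Maps from the syzygy to [I] extend to the cover
    by injectivity, and maps from the cover to [W'] lift to [I] by projectivity. *)
Lemma ext0_shift X : ext0 (syz X 1) W <-> ext0 X W'.
Proof.
have [e_inj p_surj p_ker] := ep.
have [i_inj c_surj c_ker] := syz_inclP X.
split=> [/ext0_lift XW f|XW'].
- have [h hE] := XW f.
  have [s sE] := I_inj h i_inj.
  by exists (p \o s) => x /=; rewrite sE hE.
- apply/ext0_lift => f; have [h hE] := XW' f.
  have [s sE] := free_projective h p_surj.
  by exists (s \o syz_incl X) => x /=; rewrite sE hE.
Qed.

End Shift.
End Vanishing.

(** * Vanishing of Ext through injective resolutions *)

Lemma syzS (A : nzRingType) (M : lmodType A) n : syz (syz M 1) n = syz M n.+1.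
Proof. by elim: n => //= n ->. Qed.

Section InjectiveResolution.
Variables (A : nzRingType) (U : lmodType A) (E : nat -> lmodType A).
Variables (e : {linear U -> E 0%N}) (d : forall n, {linear E n -> E n.+1}).
Hypothesis res_U : injective_resolution e d.

(** Degree 0 is [U] itself, so that for a resolution [cosyz_incl n] identifies [cosyz n] with the
    kernel of [d n] in every degree. *)
Definition cosyz n : lmodType A :=
  if n is m.+1 then submod_sort (imm (d m)) else U.

Definition cosyz_incl n : {linear cosyz n -> E n} :=
  match n with 0 => e | m.+1 => submod_incl (imm (d m)) end.

(* Vanishing of [Ext^(n+1)(X, U)]. *)
Definition lifts n (X : lmodType A) := forall f : {linear X -> E n.+1},
  (forall x, d n.+1 (f x) = 0) -> exists h : {linear X -> E n}, forall x, d n (h x) = f x.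

Lemma d_comp n x : d n.+1 (d n x) = 0.
Proof. by have [_ _ _ ->] := res_U; exists x. Qed.

Lemma cosyz_incl_inj n : injective (cosyz_incl n).
Proof. by have [_ e_inj _ _] := res_U; case: n => //= n; exact: submod_incl_inj. Qed.

Lemma cosyz_inclP n x : d n x = 0 <-> exists y, cosyz_incl n y = x.
Proof.
have [_ _ e_ex d_ex] := res_U; case: n x => [|n] x; first exact: e_ex.
split=> [/d_ex/immP/submod_exists //|[y <-] /=].
by apply/d_ex/immP; exact: (submodP (y : submod_sort (imm (d n)))).
Qed.

Lemma cosyz_ses n : exists2 p : {linear E n -> cosyz n.+1},
  ses (cosyz_incl n) p & forall x, cosyz_incl n.+1 (p x) = d n x.
Proof.
have [|p pE] := @corestrict _ _ _ (imm (d n)) (d n).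
  by move=> x; apply/immP; exists x.
exists p => //; split; first exact: cosyz_incl_inj.
- move=> y; have /immP[x xy] := submodP (y : submod_sort (imm (d n))).
  by exists x; apply: (@submod_incl_inj _ _ (imm (d n))); rewrite pE.
- move=> x; split=> [px|/cosyz_inclP dx].
    by apply/cosyz_inclP; rewrite -pE px linear0.
  by apply: (@submod_incl_inj _ _ (imm (d n))); rewrite pE dx linear0.
Qed.

Lemma ext0_cosyz n X : ext0 X (cosyz n) <-> lifts n X.
Proof.
have [E_inj _ _ _] := res_U; have [p ep pE] := cosyz_ses n.
split=> [/(ext0_lift ep (E_inj n)) Xn f df | Xn].
- have [|h hE] := factor_inj (f := f) (@cosyz_incl_inj n.+1).
    by move=> x; apply/cosyz_inclP.
  have [r rE] := Xn h; exists r => x.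
  by rewrite -pE rE hE.
- apply/(ext0_lift ep (E_inj n)) => f.
  have [|h hE] := Xn (cosyz_incl n.+1 \o f).
    by move=> x; apply/cosyz_inclP; exists (f x).
  by exists h => x; apply: (@cosyz_incl_inj n.+1); rewrite pE hE.
Qed.

(** Each step trades a syzygy in the first variable for a cosyzygy in the second. *)
Lemma ext0_syz_cosyz n j X : ext0 (syz X n) (cosyz j) <-> ext0 X (cosyz (n + j)).
Proof.
have [E_inj _ _ _] := res_U.
elim: n j => [|n IHn] j; first by rewrite add0n.
have [p ep _] := cosyz_ses j; rewrite addSnnS -IHn.
exact: (ext0_shift ep (E_inj j) (syz X n)).
Qed.

Lemma ext0_syz n X : ext0 (syz X n) U <-> lifts n X.
Proof. by rewrite -ext0_cosyz -[n in cosyz n]addn0; exact: (ext0_syz_cosyz n 0). Qed.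

Lemma lifts_projective n P : projective P -> lifts n P.
Proof.
have [E_inj _ _ _] := res_U; have [p ep pE] := cosyz_ses n.
move=> P_proj; apply/ext0_cosyz/(ext0_lift ep (E_inj n)) => f.
by have [_ p_surj _] := ep; exact: P_proj p_surj.
Qed.

(** Additivity of Ext without forming a direct sum: lift each [f \o i j] and add the composites with
    [p j]. *)
Lemma lifts_sum n (X Y : lmodType A) m (i : 'I_m -> {linear X -> Y}) (p : 'I_m -> {linear Y -> X}) :
  (forall y, \sum_j i j (p j y) = y) -> lifts n X -> lifts n Y.
Proof.
move=> ip Xn f df.
have /choice[h hE] : forall j, exists h : {linear X -> E n}, forall x, d n (h x) = f (i j x).
  by move=> j; apply: (Xn (f \o i j)) => x; exact: df.
have sL : linear (fun y => \sum_j h j (p j y)).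
  move=> a y y'; rewrite scaler_sumr -big_split; apply: eq_bigr => j _.
  by rewrite !linearP.
exists (mklinear sL) => y; rewrite [X in d n X]/= linear_sum -[in RHS](ip y) linear_sum.
by apply: eq_bigr => j _; rewrite hE.
Qed.

(** Exactness at Ext^(n+1)(K, U) in the long exact sequence. Extend [f] to [P]; composed with
    [d n.+1] the extension vanishes on [K] and descends to [M], and a lift there corrects it to a
    cocycle. *)
Lemma lifts_ses n (K P M : lmodType A) (i : {linear K -> P}) (p : {linear P -> M}) :
  ses i p -> lifts n P -> lifts n.+1 M -> lifts n K.
Proof.
have [E_inj _ _ _] := res_U.
move=> [i_inj p_surj p_ker] Pn Mn f df.
have [f' f'E] := E_inj n.+1 _ _ _ f i_inj.
have [||h hE] := factor_surj (p := p) (f := d n.+1 \o f') => //.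
  by move=> x /p_ker[k <-] /=; rewrite f'E df.
have [|r rE] := Mn h.
  by move=> y; have [x <-] := p_surj y; rewrite hE d_comp.
have [|s sE] := Pn (f' \- (r \o p)).
  by move=> x; rewrite /= linearB /= rE hE subrr.
exists (s \o i) => k.
have pik : p (i k) = 0 by apply/p_ker; exists k.
by rewrite /= sE /= f'E pik linear0 subr0.
Qed.

Lemma lifts_zero n X : zero_module (E n.+1) -> lifts n X.
Proof. by move=> E0 f _; exists (\0 : X -> E n) => x; exact: etrans (E0 _) (esym (E0 _)). Qed.

End InjectiveResolution.

(** * Ext and dimension shifting *)

Arguments precomp : simpl never.

Section Cokernels.
Variable A : nzRingType.

Definition is_coker (X Y : lmodType A) (f : {linear X -> Y}) (Q : lmodType A) :=
  exists2 p : {linear Y -> Q}, surj p & forall y, p y = 0 <-> exists x, f x = y.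

(** The hypotheses say that [t] induces a well-defined injective map from the cokernel of [f'] to
    that of [f], and that it is surjective. *)
Lemma coker_transfer (X Y X' Y' Q : lmodType A) (f : {linear X -> Y})
    (f' : {linear X' -> Y'}) (t : {linear Y' -> Y}) :
  (forall y, (exists x, f x = t y) <-> exists x, f' x = y) ->
  (forall y, exists y' x, t y' + f x = y) ->
  is_coker f Q -> is_coker f' Q.
Proof.
move=> tE t_surj [p p_surj p_ker]; exists (p \o t) => [q|y]; last by rewrite /= p_ker.
have [y <-] := p_surj q; have [y' [x <-]] := t_surj y.
exists y'; rewrite /= linearD /= (_ : p (f x) = 0) ?addr0 //.
by apply/p_ker; exists x.
Qed.

Lemma coker_image (X X' Y Q : lmodType A) (f : {linear X -> Y}) (f' : {linear X' -> Y}) :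
  (forall y, (exists x, f x = y) <-> exists x, f' x = y) -> is_coker f Q -> is_coker f' Q.
Proof.
move=> ff'; apply: (coker_transfer (t := idfun)) => // y.
by exists y, 0; rewrite linear0 addr0.
Qed.

End Cokernels.

(** Comparison with the free cover; the last two clauses make [P] the pushout of [syz_incl M] and
    [b]. *)
Lemma ses_comparison (A : nzRingType) (K P M : lmodType A)
    (i : {linear K -> P}) (p : {linear P -> M}) : ses i p ->
  exists (a : {linear {freeg M / A} -> P}) (b : {linear syz M 1 -> K}),
  [/\ forall x, p (a x) = free_cover M x, forall x, i (b x) = a (syz_incl M x),
      forall y, exists x k, a x + i k = y
    & forall x k, a x + i k = 0 -> exists2 y, syz_incl M y = x & b y = - k].
Proof.
move=> [i_inj p_surj p_ker].
have pi k : p (i k) = 0 by apply/p_ker; exists k.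
have [_ c_surj c_ker] := syz_inclP M.
have [a aE] := free_projective (free_cover M) p_surj.
have [||b bE] := factor_inj (e := i) (f := a \o syz_incl M) => //.
  by move=> x; apply/p_ker; rewrite /= aE; exact: free_cover_syz.
exists a, b; split=> //.
- move=> y; have [x xE] := c_surj (p y).
  have /p_ker[k kE] : p (y - a x) = 0 by rewrite linearB /= aE xE subrr.
  by exists x, k; rewrite kE addrC subrK.
- move=> x k xk.
  have /c_ker[y yE] : free_cover M x = 0.
    by rewrite -aE -[a x](addrK (i k)) xk linearB /= pi linear0 subrr.
  exists y => //; apply: i_inj; apply/eqP.
  have -> : i (b y) = a (syz_incl M y) := bE y.
  by rewrite yE linearN -addr_eq0 xk.
Qed.

(** Extend [f \o b] to the free cover and glue with [f] over the pushout [P]. *)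
Lemma ext0_ses (A : nzRingType) (W K P M : lmodType A)
    (i : {linear K -> P}) (p : {linear P -> M}) (f : {linear K -> W}) :
  ses i p -> ext0 M W -> exists h : {linear P -> W}, forall k, h (i k) = f k.
Proof.
move=> ip M0; have [a [b [_ bE gen rel]]] := ses_comparison ip.
have [h hE] := M0 (f \o b).
have [//||r [_ rE]] := pushout_map (a := a) (i := i) (f := h) (g := f); last by exists r.
move=> x k /rel[y <- yk].
by rewrite [h _]hE /= yk linearN addNr.
Qed.

Section ExtCokernel.
Variables (A B : nzRingType) (U : bimod A B).

Lemma precompE (M N : lmodType A) (f : {linear M -> N}) (h : Hom U N) x :
  precomp U f h x = h (f x).
Proof. by []. Qed.

(* [Q] is isomorphic to [Ext^1(X, U)]. *)
Definition is_ext1 (X : lmodType A) (Q : lmodType B) :=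
  is_coker (precomp U (syz_incl X)) Q.

(** A cocycle vanishes on the kernel of the cover [c], hence factors through [syz M n.+1];
    coboundaries become restrictions of maps from [res M n]. *)
Lemma is_ext1_Ext n (M : lmodType A) : is_ext1 (syz M n) (Ext U n.+1 M).
Proof.
rewrite /is_ext1 /= /homology.
set f := precomp U (res_d M n); set g := precomp U (res_d M n.+1).
have [q [q_surj q_ker]] := quotient_map (preimm (submod_incl (kerm g)) (imm f)).
pose c := free_cover (syz M n.+1).
have c_surj : surj c := @free_cover_surj _ _.
have [|t tE] := corestrict (S := kerm g) (f := precomp U c).
  move=> h; apply/kermP/Hom_eq => x.
  by rewrite !precompE /res_d /= free_cover_syz linear0.
exists (q \o t) => [y|h].
- have [z <-] := q_surj y.
  have /kermP z0 := submodP z.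
  have [|h hE] := factor_surj (p := c) (f := submod_incl (kerm g) z : {linear _ -> _}) c_surj.
    have [_ _ c_ker] := syz_inclP (syz M n.+1).
    move=> x /c_ker[k <-]; have [r <-] := free_cover_surj k.
    exact: (congr1 (fun w : Hom U _ => w r) z0).
  exists h => /=; congr (q _); apply: submod_incl_inj; rewrite tE.
  exact: Hom_eq.
- rewrite /= q_ker; split=> [|[k kh]].
  + move/immP=> [k]; rewrite tE => kE; exists k; apply: Hom_eq => x.
    have [y <-] := c_surj x.
    exact: (congr1 (fun w : Hom U _ => w y) kE).
  + apply/immP; exists k; rewrite tE; apply: Hom_eq => x.
    by rewrite precompE -kh.
Qed.

Lemma is_ext1_zero (X : lmodType A) Q : is_ext1 X Q -> (zero_module Q <-> ext0 X U).
Proof.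
move=> [p p_surj p_ker]; split=> [Q0 f|X0 q].
- have /p_ker[h hE] := Q0 (p f).
  by exists h => x; rewrite -[in RHS]hE.
- have [f <-] := p_surj q; have [h hE] := X0 f.
  by apply/p_ker; exists h; exact: Hom_eq.
Qed.

(** The free cover may be replaced by any presentation whose middle term has no Ext^1 into [U];
    restriction along [b] compares the cokernels. *)
Lemma coker_ext1 (K P M : lmodType A) (i : {linear K -> P}) (p : {linear P -> M}) Q :
  ses i p -> ext0 P U -> is_ext1 M Q -> is_coker (precomp U i) Q.
Proof.
move=> ip P0; have [a [b [aE bE gen rel]]] := ses_comparison ip.
apply: (coker_transfer (t := precomp U b)).
- move=> f; split=> [[h hE]|[h <-]].
  + have [//||r [_ rE]] := pushout_map (a := a) (i := i) (f := h : {linear _ -> _})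
      (g := f : {linear _ -> _}).
    * move=> x k /rel[y <- yk].
      have := congr1 (fun w : Hom U _ => w y) hE; rewrite !precompE => ->.
      by rewrite yk linearN addNr.
    * by exists r; apply: Hom_eq.
  + by exists (precomp U a h); apply: Hom_eq => x; rewrite !precompE bE.
(* The syzygy embeds in [G] with cokernel [P], so [f] extends to [G]; the two components of the
   extension give the witnesses. *)
- move=> f; pose G := ({freeg M / A} * K)%type.
  have jb_lin : linear (fun x => (syz_incl M x, - b x) : G).
    by move=> s x y; rewrite [b _]linearP [syz_incl M _]linearP opprD -scalerN.
  have G_ses : ses (mklinear jb_lin) (copair a i).
    split.
    - have [M_inj _ _] := syz_inclP M.
      by move=> x y xy; exact: (M_inj _ _ (congr1 fst xy)).
    - by move=> y; have [x [k]] := gen y; exists (x, k).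
    - move=> [x k]; rewrite copairE; split=> [/rel[y <- yk]|[y [<- <-]]].
        by exists y; rewrite /mklinear /= yk opprK.
      by rewrite linearN bE subrr.
  have [h hE] := ext0_ses (f : {linear _ -> U}) G_ses P0.
  exists (- precomp U (pair_inr _ _) h), (precomp U (pair_inl _ _) h).
  apply: Hom_eq => x; rewrite -hE.
  rewrite -[LHS]/(- h (0, b x) + h (syz_incl M x, 0)) -linearN -linearD.
  by congr (h _); rewrite /mklinear /= -[LHS]/(- 0 + syz_incl M x, - b x + 0) oppr0 add0r addr0.
Qed.

End ExtCokernel.

(** * The horseshoe lemma and dimension shifting *)

Section Horseshoe.
Variable A : nzRingType.

Lemma pair_projective (X Y : lmodType A) :
  projective X -> projective Y -> projective (X * Y)%type.
Proof.
move=> X_proj Y_proj V W q f q_surj.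
have [h hE] := X_proj _ _ q (f \o pair_inl X Y) q_surj.
have [k kE] := Y_proj _ _ q (f \o pair_inr X Y) q_surj.
exists (copair h k) => -[x y]; rewrite copairE linearD hE kE.
rewrite -[LHS]/(f (x, 0) + f (0, y)) -linearD; congr (f _).
by rewrite -[LHS]/(x + 0, 0 + y) addr0 add0r.
Qed.

(** [Q] is the kernel of the map from the sum of both covers onto [P]. The last clause pins down
    [j], so that restriction along it can be compared with restriction along [syz_incl K]. *)
Lemma horseshoe (K P M : lmodType A) (i : {linear K -> P}) (p : {linear P -> M}) :
  ses i p ->
  exists (Q : lmodType A) (j : {linear syz K 1 -> Q}) (r : {linear Q -> syz M 1})
    (s : {linear Q -> ({freeg K / A} * {freeg M / A})%type})
    (t : {linear ({freeg K / A} * {freeg M / A})%type -> P}),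
  [/\ ses j r, ses s t & forall x, s (j x) = (syz_incl K x, 0)].
Proof.
move=> ip; have [a [b [aE bE gen rel]]] := ses_comparison ip.
have [i_inj p_surj p_ker] := ip.
have pi k : p (i k) = 0 by apply/p_ker; exists k.
pose t := copair (i \o free_cover K) a.
have t_surj : surj t.
  move=> y; have [x [k <-]] := gen y; have [z <-] := free_cover_surj k.
  by exists (z, x); rewrite copairE addrC.
have [s_inj _ s_ker] := ses_kerm t_surj.
set s := submod_incl (kerm t) in s_inj s_ker.
have tE x y : t (x, y) = i (free_cover K x) + a y by [].
have [|j jE] := corestrict (S := kerm t) (f := pair_inl _ _ \o syz_incl K).
  by move=> x; apply/kermP; rewrite tE free_cover_syz !linear0 addr0.
have snd_lin : linear (fun z : {freeg K / A} * {freeg M / A} => z.2) by [].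
have [|r rE] := corestrict (S := kerm (free_cover M)) (f := mklinear snd_lin \o s).
  move=> x; apply/kermP; rewrite -aE.
  have /s_ker : exists y, s y = s x by exists x.
  change (t (s x) = 0 -> p (a (s x).2) = 0); case: (s x) => [y z]; rewrite tE [(_, _).2]/= => yz.
  by rewrite -[a z](addKr (i (free_cover K y))) yz addr0 -linearN pi.
exists (submod_sort (kerm t)), j, r, s, t; split; [|exact: ses_kerm | exact: jE].
have [cK_inj _ cK_ker] := syz_inclP K; have [cM_inj _ cM_ker] := syz_inclP M.
split.
- move=> x y /(congr1 s); rewrite !jE => xy.
  exact: (cK_inj _ _ (congr1 fst xy)).
- move=> y; have [z zE] := free_cover_surj (b (- y)).
  have /s_ker[x xE] : t (z, syz_incl M y) = 0.
    by rewrite tE zE bE -linearD linearN addNr linear0.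
  by exists x; apply: cM_inj; rewrite rE; rewrite -[LHS]/((s x).2) xE.
- move=> x; split=> [rx|[y <-]].
  + have sx2 : (s x).2 = 0 by rewrite -[LHS]/((mklinear snd_lin \o s) x) -rE rx linear0.
    have /s_ker : exists y, s y = s x by exists x.
    case sxE : (s x) sx2 => [z w]; rewrite tE [(_, _).2]/= => w0; rewrite w0 linear0 addr0 -(linear0 i).
    move=> /i_inj/cK_ker[y yE]; exists y; apply: s_inj.
    by rewrite jE sxE w0 -yE.
  + by apply: cM_inj; rewrite rE linear0 -[LHS]/((s (j y)).2) jE.
Qed.

End Horseshoe.

Section DimensionShift.
Variables (A B : nzRingType) (U : bimod A B) (E : nat -> lmodType A).
Variables (e : {linear U -> E 0%N}) (d : forall n, {linear E n -> E n.+1}).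
Hypothesis res_U : injective_resolution e d.

Lemma zero_Ext_lifts n M : zero_module (Ext U n.+1 M) <-> lifts d n M.
Proof. by rewrite (is_ext1_zero (is_ext1_Ext U n M)) -(ext0_syz res_U). Qed.

Lemma ext0_lifts0 M : ext0 M U <-> lifts d 0 M.
Proof. exact: (ext0_syz res_U 0). Qed.

(** [Q] is Ext^(n+2)(M, U) and becomes Ext^(n+1)(K, U); keeping one [Q] avoids composing
    isomorphisms. The induction passes to the syzygy sequence of the horseshoe, whose middle term is
    again acyclic. *)
Lemma is_ext1_shift n (K P M : lmodType A) (i : {linear K -> P}) (p : {linear P -> M}) Q :
  ses i p -> (forall m, lifts d m P) ->
  is_ext1 U (syz M n.+1) Q -> is_ext1 U (syz K n) Q.
Proof.
elim: n K P M i p => [|n IHn] K P M i p ip P_lifts extQ.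
all: have [X [j [r [s [t [jr st sjE]]]]]] := horseshoe ip.
all: have X_lifts m : lifts d m X by
  apply: (lifts_ses res_U st) => //; apply: (lifts_projective res_U);
  apply: pair_projective; exact: free_projective.
- have Xj : is_coker (precomp U j) Q.
    by apply: (coker_ext1 jr) extQ; apply/ext0_lifts0.
  (* Maps on [X] extend to the sum of the covers because Ext^1(P, U) vanishes, so maps on [X] and on
     the cover of [K] have the same restrictions to the syzygy of [K]. *)
  apply: coker_image Xj => f; split=> [[h <-]|[h <-]].
  + have P0 : ext0 P U by apply/ext0_lifts0.
    have [h' hE] := ext0_ses (h : {linear _ -> _}) st P0.
    exists (precomp U (pair_inl _ _) h'); apply: Hom_eq => x.
    by rewrite !precompE -hE sjE.
  + pose q : Hom U _ := copair (h : {linear _ -> _}) (\0 : {freeg M / A} -> U).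
    exists (precomp U s q); apply: Hom_eq => x.
    by rewrite !precompE sjE /q copairE addr0.
- rewrite -syzS; apply: IHn jr X_lifts _; by rewrite syzS.
Qed.

End DimensionShift.

(** * Duality *)

Section Evaluation.
Variables (A B : nzRingType) (U : bimod A B) (M : lmodType A) (Z : lmodType B).
Variable j : {linear Z -> Hom U M}.

Lemma eval_linear (x : M) : linear (fun z => j z x : flip U).
Proof. by move=> b z z'; rewrite linearP. Qed.

Definition eval_at (x : M) : Hom (flip U) Z := mklinear (eval_linear x).

Lemma eval_at_linear : linear eval_at.
Proof.
move=> a x y; apply: Hom_eq => z.
by change (j z (a *: x + y) = a *: j z x + j z y); rewrite linearP.
Qed.

(** For [j] the identity this is the map from [M] to its bidual; for an inclusion it is that map
    followed by restriction to [Z]. *)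
Definition eval : {linear M -> Hom (flip U) Z} := mklinear eval_at_linear.

Lemma evalE x z : eval x z = j z x.
Proof. by []. Qed.

End Evaluation.

Section RowVectors.
Variables (A B : nzRingType) (U : bimod A B) (n : nat).

Lemma row_projective : projective 'rV[A]_n.
Proof.
move=> X Y q f q_surj.
have [c cE] := choice (fun i => q_surj (f (delta_mx 0 i))).
have c_lin : linear (fun r : 'rV[A]_n => \sum_i r 0 i *: c i).
  move=> a r s; rewrite scaler_sumr -big_split; apply: eq_bigr => i _.
  by rewrite !mxE scalerDl scalerA.
exists (mklinear c_lin) => r; rewrite [X in q X]/= linear_sum.
rewrite [in RHS](row_sum_delta r) linear_sum; apply: eq_bigr => i _.
by rewrite !linearZ cE.
Qed.

Lemma row_coord_linear (i : 'I_n) (u : U) : linear (fun r : 'rV[A]_n => r 0 i *: u).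
Proof. by move=> a r s; rewrite !mxE scalerDl scalerA. Qed.

Lemma row_dual_linear (i : 'I_n) :
  linear (fun u : flip U => mklinear (row_coord_linear i u) : Hom U 'rV[A]_n).
Proof.
move=> b u v; apply: Hom_eq => r.
by change (r 0 i *: (biact b u + v) = biact b (r 0 i *: u) + r 0 i *: v);
  rewrite scalerDr biactZ.
Qed.

Definition row_dual (i : 'I_n) : {linear flip U -> Hom U 'rV[A]_n} :=
  mklinear (row_dual_linear i).

Lemma row_dualE i u r : row_dual i u r = r 0 i *: (u : U).
Proof. by []. Qed.

Definition row_coord (i : 'I_n) : {linear Hom U 'rV[A]_n -> flip U} :=
  eval (idfun : {linear Hom U 'rV[A]_n -> Hom U 'rV[A]_n}) (delta_mx 0 i) : {linear _ -> _}.

Lemma row_dual_coord (f : Hom U 'rV[A]_n) : \sum_i row_dual i (row_coord i f) = f.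
Proof.
apply: Hom_eq => r; rewrite [in RHS](row_sum_delta r) linear_sum.
have sumE (s : seq 'I_n) (F : 'I_n -> Hom U 'rV[A]_n) :
    (\sum_(i <- s) F i) r = \sum_(i <- s) F i r.
  by elim: s => [|i s IHs]; rewrite ?big_nil // !big_cons -IHs.
rewrite sumE; apply: eq_bigr => i _.
by rewrite row_dualE linearZ.
Qed.

(** [F] restricted to the i-th copy of [U] is an endomorphism of [flip U], hence a homothety; its
    scalar is the i-th coordinate. *)
Lemma row_eval_surj : faithfully_balanced U ->
  forall F : Hom (flip U) (Hom U 'rV[A]_n), exists x, forall f, F f = f x.
Proof.
move=> [[h _ hK] _] F.
pose x := \row_i h (F \o row_dual i : {linear flip U -> flip U}).
exists x => f.
rewrite -[in LHS](row_dual_coord f) linear_sum [in RHS](row_sum_delta x) linear_sum.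
apply: eq_bigr => i _; rewrite linearZ mxE.
pose G : {linear flip U -> flip U} := F \o row_dual i.
by rewrite -[LHS]/(G (row_coord i f)) -[in LHS](hK G).
Qed.

Lemma row_eval_inj : faithfully_balanced U ->
  forall x : 'rV[A]_n, (forall f : Hom U 'rV[A]_n, f x = 0) -> x = 0.
Proof.
move=> [bal _] x fx0; apply/rowP => i; rewrite mxE; apply: (bij_inj bal).
apply: (@Hom_eq _ _ (flip U) (flip U)) => u.
change (x 0 i *: (u : U) = 0 *: (u : U)).
by rewrite scale0r -row_dualE fx0.
Qed.

Lemma row_dual_lifts E d m : (forall k, lifts d k (flip U)) -> 
  @lifts _ E d m (Hom U 'rV[A]_n).
Proof. move=> Ul; apply: lifts_sum row_dual_coord (Ul m). Qed.

End RowVectors.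

(** * Reflexivity of acyclic modules and the double Ext *)

Section Duality.
Variables (A B : nzRingType) (U : bimod A B).
Variables (E : nat -> lmodType A) (e : {linear U -> E 0%N}).
Variable d : forall n, {linear E n -> E n.+1}.
Variables (E' : nat -> lmodType B) (e' : {linear flip U -> E' 0%N}).
Variable d' : forall n, {linear E' n -> E' n.+1}.
Hypotheses (res_U : injective_resolution e d) (res_U' : injective_resolution e' d').
Hypothesis bal : faithfully_balanced U.
Hypothesis self_U' : forall n, lifts d' n (flip U).
Hypothesis fg_cover : forall M : lmodType A, fg_module M ->
  exists n (K : lmodType A) (i : {linear K -> 'rV[A]_n}) (p : {linear 'rV[A]_n -> M}),
    ses i p /\ fg_module K.
Variable g : nat.
Hypothesis injdim_U' : forall n (X : lmodType B), (g <= n)%N -> lifts d' n X.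

Lemma dual_ses (K P M : lmodType A) (i : {linear K -> P}) (p : {linear P -> M}) :
  ses i p -> ext0 M U -> ses (precomp U p) (precomp U i).
Proof.
move=> ip M0; have [i_inj p_surj p_ker] := ip; split.
- move=> f h fh; apply: Hom_eq => y; have [x <-] := p_surj y.
  exact: (congr1 (fun w : Hom U _ => w x) fh).
- move=> f; have [h hE] := ext0_ses (f : {linear _ -> U}) ip M0.
  by exists h; apply: Hom_eq.
- move=> f; split=> [f0|[h <-]].
  + have [|h hE] := factor_surj (f := f : {linear _ -> _}) p_surj.
      move=> x /p_ker[k <-]; exact: (congr1 (fun w : Hom U _ => w k) f0).
    by exists h; apply: Hom_eq.
  + apply: Hom_eq => k; rewrite !precompE (_ : p (i k) = 0) ?linear0 //.
    by apply/p_ker; exists k.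
Qed.

Lemma syzygy_lifts n m (K M : lmodType A) (i : {linear K -> 'rV[A]_m}) (p : {linear 'rV[A]_m -> M}) :
  ses i p -> lifts d n.+1 M -> lifts d n K.
Proof.
move=> ip; apply: (lifts_ses res_U ip).
by apply: (lifts_projective res_U); exact: row_projective.
Qed.

(** Descending induction on the degree from [g]: the dual of the syzygy satisfies the claim one
    degree higher, and the dualised presentation brings it down to [M]. *)
Lemma dual_lifts (M : lmodType A) : fg_module M -> (forall n, lifts d n M) ->
  forall n, lifts d' n (Hom U M).
Proof.
move=> fgM Ml n; have : (g <= n + g)%N by rewrite leq_addl.
elim: {2}g n M fgM Ml => [|m IHm] n M fgM Ml.
  by rewrite addn0 => /injdim_U'.
rewrite -addSnnS => gn.
have [r [K [i [p [ip fgK]]]]] := fg_cover fgM.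
have M0 : ext0 M U by apply/(ext0_lifts0 res_U).
have Kl k : lifts d k K by exact: syzygy_lifts ip (Ml k.+1).
apply: (lifts_ses res_U' (dual_ses ip M0)); last exact: IHm.
exact: row_dual_lifts.
Qed.

(** Ext^1 of the dual of [K] vanishes, so [F] extends to the dual of the free module, where it is
    evaluation at a vector. *)
Lemma eval_surj (M : lmodType A) : fg_module M -> (forall n, lifts d n M) ->
  forall F : Hom (flip U) (Hom U M), exists x, forall f, F f = f x.
Proof.
move=> fgM Ml F; have [r [K [i [p [ip fgK]]]]] := fg_cover fgM.
have M0 : ext0 M U by apply/(ext0_lifts0 res_U).
have Kl k : lifts d k K by exact: syzygy_lifts ip (Ml k.+1).
have K0 : ext0 (Hom U K) (flip U).
  by apply/(ext0_lifts0 res_U'); exact: dual_lifts.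
have [F' F'E] := ext0_ses (F : {linear _ -> _}) (dual_ses ip M0) K0.
have [x xE] := row_eval_surj bal F'.
by exists (p x) => f; rewrite -F'E xE.
Qed.

(** If every functional kills [p y], evaluation at [y] factors through the dual of [K] and is
    evaluation at some [k]; then [y = i k] in the free module. *)
Lemma eval_inj (M : lmodType A) : fg_module M -> (forall n, lifts d n M) ->
  forall x : M, (forall f : Hom U M, f x = 0) -> x = 0.
Proof.
move=> fgM Ml x fx0; have [r [K [i [p [ip fgK]]]]] := fg_cover fgM.
have M0 : ext0 M U by apply/(ext0_lifts0 res_U).
have Kl k : lifts d k K by exact: syzygy_lifts ip (Ml k.+1).
have [i_inj p_surj p_ker] := ip; have [y yE] := p_surj x.
have [_ pi_surj pi_ker] := dual_ses ip M0.
have [|F FE] := factor_surj (f := eval (idfun : {linear Hom U _ -> _}) y : {linear _ -> _}) pi_surj.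
  by move=> f /pi_ker[h <-]; rewrite -[LHS]/(h (p y)) yE fx0.
have [k kE] := eval_surj fgK Kl F.
rewrite -yE; suff -> : y = i k by apply/p_ker; exists k.
apply/eqP; rewrite -subr_eq0; apply/eqP/(row_eval_inj bal) => f.
by rewrite linearB /= -[f y]/(eval (idfun : {linear Hom U _ -> _}) y f) -FE kE subrr.
Qed.

(* [Z] is the image of [P^* -> K^*].  Splicing the short exact sequences
   [0 -> Z -> P'^* -> Z' -> 0] of successive syzygies resolves [Y = Ext^(n+1)(M, U)]
   by [U]-acyclic modules. *)
Lemma Ext_dual_shift n : forall (M : lmodType A) (Y : lmodType B),
  fg_module M -> (forall m, m <> n -> lifts d m M) -> is_ext1 U (syz M n) Y ->
  forall r (K : lmodType A) (i : {linear K -> 'rV[A]_r}) (p : {linear 'rV[A]_r -> M}),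
  ses i p -> fg_module K ->
  let Z := imm (precomp U i) in
  (forall j W, is_ext1 (flip U) (syz Y (j + n).+1) W ->
     is_ext1 (flip U) (syz (submod_sort Z) j) W) /\
  (forall W, is_ext1 (flip U) (syz Y n) W -> is_coker (eval (submod_incl Z)) W).
Proof.
elim: n => [|n IHn] M Y fgM Ml extY r K i p ip fgK Z.
- have Kl m : lifts d m K by exact: syzygy_lifts ip (Ml m.+1 _).
  have [q q_surj q_ker] : is_coker (precomp U i) Y.
    apply: coker_ext1 ip _ extY; apply/(ext0_lifts0 res_U)/(lifts_projective res_U).
    exact: row_projective.
  have ZY : ses (submod_incl Z) q.
    split=> //; first exact: submod_incl_inj.
    move=> x; rewrite q_ker; split=> [/immP/submod_exists //|[z <-]].
    by apply/immP; exact: submodP.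
  have K'l m : lifts d' m (Hom U K) by exact: dual_lifts.
  split=> [j|] W; first by rewrite addn0; exact: (is_ext1_shift res_U' ZY).
  move=> extW; have K'0 : ext0 (Hom U K) (flip U) by apply/(ext0_lifts0 res_U').
  (* By [eval_surj], [K] and its bidual have the same image in the dual of [Z]. *)
  apply: coker_image (coker_ext1 ZY K'0 extW) => F; split=> [[G <-]|[k <-]].
  + have [k kE] := eval_surj fgK Kl G.
    by exists k; apply: Hom_eq => z; rewrite precompE kE.
  + exists (eval (idfun : {linear Hom U K -> Hom U K}) k).
    exact: Hom_eq.
- have [s [L [j [q [jq fgL]]]]] := fg_cover fgK.
  have P0 m : lifts d m 'rV[A]_r by apply: (lifts_projective res_U); exact: row_projective.
  (* Passing to the syzygy lowers the degree and keeps [Y], so the induction hypothesis applies to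
     [K]. *)
  have extY' : is_ext1 U (syz K n) Y by exact: (is_ext1_shift res_U ip) extY.
  have [|IHshift IHcoker] := IHn K Y fgK _ extY' s L j q jq fgL.
    by move=> m mn; apply: syzygy_lifts ip (Ml m.+1 _) => -[].
  set Z' := imm (precomp U j) in IHshift IHcoker.
  have M0 : ext0 M U by apply/(ext0_lifts0 res_U); exact: Ml.
  (* Ext^1(M, U) vanishes, so every functional on [K] extends and [Z] is the whole dual of [K]. *)
  have ZK (f : Hom U K) : f \in Z.
    have [h hE] := ext0_ses (f : {linear _ -> _}) ip M0.
    by apply/immP; exists h; apply: Hom_eq.
  have [|t tE] := corestrict (S := Z') (f := precomp U j).
    by move=> f; apply/immP; exists f.
  have ZZ' : ses (precomp U q \o submod_incl Z) t.
    have [j_inj q_surj q_ker] := jq; split.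
    + move=> x y; rewrite /= => xy; apply: submod_incl_inj; apply: Hom_eq => k.
      have [z <-] := q_surj k; exact: (congr1 (fun w : Hom U _ => w z) xy).
    + move=> y; have /immP[f fE] := submodP y.
      by exists f; apply: submod_incl_inj; rewrite tE.
    + move=> f; split=> [tf|[z <-]].
      * have fj : precomp U j f = 0 by rewrite -tE tf linear0.
        have [|h hE] := factor_surj (f := f : {linear _ -> _}) q_surj.
          by move=> x /q_ker[k <-]; exact: (congr1 (fun w : Hom U _ => w k) fj).
        have [z zE] := submod_exists (ZK h).
        by exists z; apply: Hom_eq => x; rewrite -hE -zE.
      * apply: submod_incl_inj; rewrite tE linear0; apply: Hom_eq => k.
        rewrite precompE -[LHS]/(submod_incl Z z (q (j k))) (_ : q (j k) = 0) ?linear0 //.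
        by apply/q_ker; exists k.
  have P'l m : lifts d' m (Hom U 'rV[A]_s) by exact: row_dual_lifts.
  split=> [l|] W extW.
  + apply: (is_ext1_shift res_U' ZZ' P'l); apply: IHshift.
    by rewrite addSnnS.
  + have P'0 : ext0 (Hom U 'rV[A]_s) (flip U) by apply/(ext0_lifts0 res_U').
    have := coker_ext1 ZZ' P'0 (IHshift 0 W extW).
    apply: coker_image => F; split=> [[G <-]|[k <-]].
    * have [x xE] := row_eval_surj bal G.
      exists (q x); apply: Hom_eq => z; rewrite precompE xE.
      by rewrite evalE.
    * have [_ q_surj _] := jq; have [x <-] := q_surj k.
      exists (eval (idfun : {linear Hom U 'rV[A]_s -> Hom U 'rV[A]_s}) x).
      exact: Hom_eq.
Qed.

(** For positive [g], Hom(M, U) vanishes, so [Z] is the dual of the free module and the dual of [Z]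
    is the free module itself. The cokernel in [Ext_dual_shift] is then its quotient by [K], that
    is, [M]. *)
Lemma Ext_Ext_iso (M : lmodType A) :
  fg_module M -> (forall n, n <> g -> zero_module (Ext U n M)) ->
  iso_module M (Ext (flip U) g (Ext U g M)).
Proof.
move=> fgM extM.
have Ml n : n.+1 <> g -> lifts d n M by move=> /extM/(zero_Ext_lifts res_U).
case: g extM Ml => [|n] extM Ml.
  have {}Ml n : lifts d n M by exact: Ml.
  apply: (@iso_of_rel _ M (Hom (flip U) (Hom U M)) (fun x F => forall f, F f = f x)).
  - by move=> x; exists (eval (idfun : {linear Hom U M -> Hom U M}) x).
  - move=> a x F x' F' FE F'E f.
    by rewrite linearP -FE -F'E.
  - by move=> F F0; apply: Hom_eq => f; rewrite F0 linear0.
  - exact: eval_surj.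
  - by move=> x x0; apply: (eval_inj fgM Ml) => f; rewrite -x0.
have {}Ml m : m <> n -> lifts d m M by move=> mn; apply: Ml => -[].
have M0 : zero_module (Hom U M) by exact: (extM 0).
have [r [K [i [p [ip fgK]]]]] := fg_cover fgM.
have extY := is_ext1_Ext U n M.
have extW := is_ext1_Ext (flip U) n (Ext U n.+1 M).
have [_ shiftW] := Ext_dual_shift fgM Ml extY ip fgK.
have [q q_surj q_ker] := shiftW _ extW.
have [i_inj p_surj p_ker] := ip; set Z := imm (precomp U i) in q q_surj q_ker.
(* [F] is evaluation at a representative [y] of [x], once [Z] is identified with the dual of the
   free module. *)
pose R x w := exists2 y, p y = x & exists2 F : Hom (flip U) (submod_sort Z), q F = w &
  forall z f, precomp U i f = submod_incl Z z -> F z = f y.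
apply: (@iso_of_rel _ _ _ R).
- move=> x; have [y yE] := p_surj x.
  (* Well defined because a functional vanishing on [K] comes from Hom(M, U), which is zero. *)
  have [||| F FE] := @linear_of_rel _ (submod_sort Z) (flip U)
    (fun z u => exists2 f, precomp U i f = submod_incl Z z & f y = u).
  + by move=> z; have /immP[f fE] := submodP z; exists (f y), f.
  + move=> b z u z' u' [f fz <-] [f' fz' <-].
    by exists (b *: f + f'); rewrite ?linearP ?fz ?fz'.
  + move=> u [f]; rewrite linear0 => f0 <-.
    have [|h hE] := factor_surj (f := f : {linear _ -> _}) p_surj.
      by move=> z /p_ker[k <-]; exact: (congr1 (fun w : Hom U _ => w k) f0).
    by rewrite -hE (M0 h).
  + exists (q F), y => //; exists F => // z f fz.
    by apply/FE; exists f.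
- move=> a x w x' w' [y <- [F <- FE]] [y' <- [F' <- F'E]].
  exists (a *: y + y'); first by rewrite linearP.
  exists (a *: F + F'); first by rewrite linearP.
  by move=> z f fz; rewrite linearP -(FE _ _ fz) -(F'E _ _ fz).
- move=> w [y /p_ker[k <-] [F <- FE]]; apply/q_ker; exists k.
  apply: Hom_eq => z; have /immP[f fz] := submodP z.
  by rewrite (FE _ _ fz) evalE -fz.
- move=> w; have [F FE] := q_surj w.
  have [|t tE] := corestrict (S := Z) (f := precomp U i).
    by move=> f; apply/immP; exists f.
  have [y yE] := row_eval_surj bal (F \o t : {linear _ -> _}).
  exists (p y), y => //; exists F => // z f fz; rewrite -yE /=; congr (F _).
  by apply: submod_incl_inj; rewrite tE.
- move=> x [y <- [F /q_ker[k <-] FE]].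
  suff -> : y = i k by apply/p_ker; exists k.
  apply/eqP; rewrite -subr_eq0; apply/eqP/(row_eval_inj bal) => f.
  have /submod_exists[z zE] : precomp U i f \in Z by apply/immP; exists f.
  by rewrite linearB /= -(FE z f) // evalE zE precompE subrr.
Qed.

End Duality.

(** * Modules of large strong grade *)

Section DirectSum.
Variables (A : nzRingType) (E : nat -> lmodType A) (M : lmodType A).

Lemma dsum_zero n : (forall f : {linear M -> dsum E n}, forall x, f x = 0) <->
  forall i, (i < n)%N -> forall f : {linear M -> E i}, forall x, f x = 0.
Proof.
elim: n => [|n IHn].
  by split=> // _ f x; apply/rowP => -[].
have [fst_lin snd_lin] : linear (fun z : dsum E n * E n => z.1) /\
                         linear (fun z : dsum E n * E n => z.2) by [].
split=> [f0 i|E0 f x].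
- rewrite ltnS leq_eqVlt => /predU1P[-> f x|].
    exact: (congr1 snd (f0 (pair_inr (dsum E n) (E n) \o f) x)).
  apply: IHn.1 => f x.
  exact: (congr1 fst (f0 (pair_inl (dsum E n) (E n) \o f) x)).
- rewrite [LHS]surjective_pairing; congr (_, _).
    apply: (IHn.2 _ (mklinear fst_lin \o f)) => i ltin; apply: E0; exact: ltnW.
  exact: (E0 n (leqnn _) (mklinear snd_lin \o f)).
Qed.

End DirectSum.

Section MinimalResolution.
Variables (A B : nzRingType) (U : bimod A B) (E : nat -> lmodType A).
Variables (e : {linear U -> E 0%N}) (d : forall n, {linear E n -> E n.+1}).

Lemma grade_zero_maps g (W X : lmodType A) (j : {linear X -> W}) :
  minimal_injective_resolution e d -> sgrade_ge U W g -> injective j ->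
  forall i, (i < g)%N -> forall f : {linear X -> E i}, forall x, f x = 0.
Proof.
move=> [res_U e_ess d_ess] Wg + i.
(* The grade condition concerns submodules of [W] given as predicates; it is carried from the image
   of [k] to [Y]. *)
have sub_zero n (Y : lmodType A) (k : {linear Y -> W}) : injective k ->
    (n < g)%N -> zero_module (Ext U n Y).
  move=> k_inj ng.
  have [|t tE] := corestrict (S := imm k) (f := k).
    by move=> y; apply/immP; exists y.
  have [||s sE] := factor_inj (e := k) (f := submod_incl (imm k)) => //.
    by move=> z; have /immP[y yE] := submodP z; exists y.
  have st y : s (t y) = y by apply: k_inj; rewrite sE tE.
  have := Wg (imm k) n ng; case: n {ng} => [|n].
    move=> S0 f; apply: Hom_eq => y.
    by rewrite -(st y); exact: (congr1 (fun w : Hom U _ => w (t y)) (S0 (precomp U s f))).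
  move=> /(zero_Ext_lifts res_U) Sl; apply/(zero_Ext_lifts res_U) => f df.
  have [h hE] := Sl (f \o s) (fun x => df (s x)).
  by exists (h \o t) => y; rewrite -[LHS]/(d n (h (t y))) hE /= st.
elim: i X j => [|i IHi] X j j_inj ig f x; apply: contrapT => fx0.
(* [Y] is the preimage under [f] of the kernel of the next differential. *)
all: have [Y [k [k_inj kE]]] : exists (Y : lmodType A) (k : {linear Y -> X}),
  injective k /\ forall x, (exists y, k y = x) <-> d _ (f x) = 0 by
  exists (submod_sort (kerm (d _ \o f))), (submod_incl _); split;
    [exact: submod_incl_inj | exact: kerm_incl].
all: have f_ess : exists2 y, y \in imm f & y != 0 by
  exists (f x); [apply/immP; exists x | apply/eqP].
(* Minimality gives a nonzero value of [f] in the image of [e]; the rest shows that this value is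
   zero. *)
- have [u [/immP[y yE] /eqP[]]] := e_ess _ f_ess.
  have [_ e_inj e_ex _] := res_U.
  have [|h hE] := factor_inj (f := f \o k) e_inj.
    by move=> z; apply/e_ex/kE; exists z.
  have /kE[z zE] : d 0 (f y) = 0 by rewrite yE; apply/e_ex; exists u.
  have h0 : h = 0 :> Hom U Y := sub_zero 0 _ (j \o k) (inj_comp j_inj k_inj) ig h.
  rewrite -yE -zE -[LHS]/((f \o k) z) -hE.
  by rewrite -[h z]/((h : Hom U Y) z) h0 -[X in e X]/(0 : U) linear0.
- have [u [/immP[y yE] /eqP[]]] := d_ess i _ f_ess.
  have jk_inj : injective (j \o k) := inj_comp j_inj k_inj.
  (* This makes the restriction of [f] to [Y] factor through [E i], where maps from [Y] vanish by
     induction. *)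
  have /(zero_Ext_lifts res_U) Yl := sub_zero i.+1 _ (j \o k) jk_inj ig.
  have [|h hE] := Yl (f \o k).
    by move=> z; apply/kE; exists z.
  have /kE[z zE] : d i.+1 (f y) = 0 by rewrite yE (d_comp res_U).
  rewrite -yE -zE -[LHS]/((f \o k) z) -hE (IHi _ _ jk_inj (ltnW ig)).
  by rewrite linear0.
Qed.

Lemma lifts_zero_maps i (M : lmodType A) : injective_resolution e d ->
  (forall f : {linear M -> E i}, forall x, f x = 0) -> zero_module (Ext U i M).
Proof.
move=> res_U; have [_ e_inj _ _] := res_U; case: i => [|i] M0.
  move=> f; apply: Hom_eq => x; apply: e_inj.
  by rewrite -[LHS]/((e \o (f : {linear M -> U})) x) M0 -[X in e X]/(0 : U) linear0.
apply/(zero_Ext_lifts res_U) => f _; exists (\0 : M -> E i) => x.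
by rewrite linear0 M0.
Qed.

End MinimalResolution.

(** * Artin algebras are noetherian *)

Section Span.
Variables (A : nzRingType) (V : lmodType A).

Definition linclosed (P : V -> Prop) :=
  P 0 /\ forall a x y, P x -> P y -> P (a *: x + y).

Fixpoint span (s : seq V) (x : V) : Prop :=
  if s is v :: s' then exists a y, span s' y /\ x = a *: v + y else x = 0.

Definition fg_pred (P : V -> Prop) := exists s : seq V,
  (forall x, x \in s -> P x) /\ forall x, P x -> span s x.

Lemma linclosedZ P a x : linclosed P -> P x -> P (a *: x).
Proof. by move=> [P0 PL] Px; rewrite -[a *: x]addr0; exact: PL. Qed.

Lemma linclosedB P x y : linclosed P -> P x -> P y -> P (x - y).
Proof. by move=> [P0 PL] Px Py; rewrite addrC -scaleN1r; exact: PL. Qed.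

Lemma span_linclosed s : linclosed (span s).
Proof.
elim: s => [|v s [IH0 IHL]].
  by split=> // a x y /= -> ->; rewrite scaler0 addr0.
split; first by exists 0, 0; rewrite scale0r addr0.
move=> a x y [b [x' [sx' ->]]] [c [y' [sy' ->]]].
exists (a * b + c), (a *: x' + y'); split; first exact: IHL.
by rewrite scalerDr scalerDl scalerA addrACA.
Qed.

Lemma span_mem s x : x \in s -> span s x.
Proof.
elim: s => // v s IHs; rewrite inE => /predU1P[->|/IHs sx].
  by exists 1, 0; rewrite scale1r addr0; split=> //; exact: (span_linclosed s).1.
by exists 0, x; rewrite scale0r add0r.
Qed.

Lemma span_min s (P : V -> Prop) :
  linclosed P -> (forall x, x \in s -> P x) -> forall x, span s x -> P x.
Proof.
move=> [P0 PL]; elim: s => [_ x -> //|v s IHs sP x [a [y [sy ->]]]].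
apply: PL; first by apply: sP; rewrite mem_head.
by apply: IHs sy => z zs; apply: sP; rewrite inE zs orbT.
Qed.

Lemma span_sub s t : {subset s <= t} -> forall x, span s x -> span t x.
Proof. by move=> st; apply: span_min (span_linclosed t) _ => x /st; exact: span_mem. Qed.

Lemma span_sumP s x :
  span s x <-> exists c : nat -> A, x = \sum_(i < size s) c i *: s`_i.
Proof.
elim: s x => [|v s IHs] x /=.
  split=> [->|[c ->]]; last by rewrite big_ord0.
  by exists (fun=> 0); rewrite big_ord0.
split=> [[a [y [/IHs[c ->] ->]]]|[c ->]].
  exists (fun i => if i is j.+1 then c j else a).
  by rewrite big_ord_recl.
exists (c 0), (\sum_(i < size s) c i.+1 *: s`_i); rewrite big_ord_recl; split=> //.
by apply/IHs; exists (fun i => c i.+1).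
Qed.

Lemma fg_module_span : fg_module V <-> exists s, forall x, span s x.
Proof. by split=> -[s sV]; exists s => x; apply/span_sumP; exact: sV. Qed.

End Span.

Section SpanMap.
Variables (A : nzRingType) (V W : lmodType A) (f : {linear V -> W}).

Lemma span_map s x : span s x -> span (map f s) (f x).
Proof.
elim: s x => [x ->|v s IHs x [a [y [sy ->]]]]; first by rewrite linear0.
by exists a, (f y); rewrite linearP; split=> //; exact: IHs.
Qed.

Lemma span_map_exists s y : span (map f s) y -> exists2 x, span s x & f x = y.
Proof.
elim: s y => [_ ->|v s IHs _ [a [y [/IHs[x sx <-] ->]]]].
  by exists 0; rewrite ?linear0.
by exists (a *: v + x); rewrite ?linearP //; exists a, x.
Qed.

Lemma seq_lift (P : V -> Prop) (s : seq W) :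
  (forall y, y \in s -> exists2 x, P x & f x = y) ->
  exists2 t, (forall x, x \in t -> P x) & map f t = s.
Proof.
elim: s => [|y s IHs] sP; first by exists [::].
have [|t tP <-] := IHs; first by move=> z zs; apply: sP; rewrite inE zs orbT.
have [|x Px <-] := sP y; first by rewrite mem_head.
by exists (x :: t) => // z; rewrite inE => /predU1P[->|/tP].
Qed.

Lemma fg_pred_ext (P : V -> Prop) : linclosed P ->
  fg_pred (fun y => exists2 x, P x & f x = y) ->
  fg_pred (fun x => P x /\ f x = 0) -> fg_pred P.
Proof.
move=> P_lin [s [/seq_lift[t tP <-] sE]] [u [uP uE]].
exists (t ++ u); split=> [x|x Px].
  by rewrite mem_cat => /orP[/tP|/uP[]].
have [|y ty yx] := span_map_exists (sE (f x) _); first by exists x.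
rewrite -[x](subrK y) -[x - y]scale1r; apply: (span_linclosed _).2.
- apply: (@span_sub _ _ u) => [z zu|]; first by rewrite mem_cat zu orbT.
  apply: uE; rewrite linearB /= yx subrr; split=> //.
  by apply: linclosedB => //; exact: (span_min P_lin tP).
- by apply: (@span_sub _ _ t) ty => z zt; rewrite mem_cat zt.
Qed.

Lemma fg_surj : surj f -> fg_module V -> fg_module W.
Proof.
move=> f_surj /fg_module_span[s sV]; apply/fg_module_span; exists (map f s) => y.
by have [x <-] := f_surj y; exact: span_map.
Qed.

End SpanMap.

Section Artinian.
Variables (k : comNzRingType) (k_art : artinian k).

Lemma artinian_dcc (I : nat -> k^o -> Prop) : (forall n, linclosed (I n)) ->
  (forall n x, I n.+1 x -> I n x) -> exists n, forall x, I n x -> I n.+1 x.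
Proof.
move=> I_lin I_dec.
have S_closed n : GRing.subsemimod_closed [pred x : k^o | `[< I n x >]].
  have [I0 IL] := I_lin n; split; first split; rewrite ?inE.
  - exact/asboolP.
  - move=> x y /asboolP Ix /asboolP Iy; apply/asboolP.
    by rewrite -[x]scale1r; exact: IL.
  - move=> a x /asboolP Ix; apply/asboolP; exact: linclosedZ.
have [|n nE] := k_art (I := fun n => Submod (S_closed n)).
  by move=> n x /asboolP/I_dec Ix; exact/asboolP.
exists n => x Ix; apply/asboolP.
by have := nE n.+1 (leqnSn n) x; rewrite /in_mem /= => ->; exact/asboolP.
Qed.

Lemma artinian_minimal (C : (k^o -> Prop) -> Prop) I :
  linclosed I -> C I -> exists J, [/\ linclosed J, C J &
    forall J', linclosed J' -> C J' -> (forall x, J' x -> J x) -> forall x, J x -> J' x].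
Proof.
move=> I_lin CI; apply: contrapT => no_min.
pose T := {J : k^o -> Prop | linclosed J /\ C J}.
have step (J : T) : exists J' : T, (forall x, sval J' x -> sval J x) /\
    ~ (forall x, sval J x -> sval J' x).
  apply: contrapT => noJ; case: no_min; case: J noJ => J [J_lin CJ] noJ.
  exists J; split=> // J' J'_lin CJ' J'J.
  apply: contrapT => JJ'; case: noJ.
  by exists (exist _ J' (conj J'_lin CJ')).
have [next nextP] := choice step.
pose S n := iter n next (exist _ I (conj I_lin CI)).
have [||n] := @artinian_dcc (fun n => sval (S n)).
- by move=> n; case: (svalP (S n)).
- by move=> n x; exact: (nextP (S n)).1.
- exact: (nextP (S n)).2.
Qed.

(** The image and the kernel of multiplication by [a] on [J] cannot both be finitely generated; by
    minimality, one that is not equals [J]. *)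
Lemma minimal_mul (J : k^o -> Prop) : linclosed J -> ~ fg_pred J ->
  (forall J', linclosed J' -> ~ fg_pred J' -> (forall x, J' x -> J x) ->
     forall x, J x -> J' x) ->
  forall a, (forall x, J x -> a * x = 0) \/ (forall y, J y -> exists2 x, J x & a * x = y).
Proof.
move=> J_lin J_nfg J_min a; have [J0 JL] := J_lin.
have mul_lin : linear (fun x : k^o => a * x : k^o).
  by move=> c x y; rewrite mulrDr; congr (_ + _); exact: mulrCA.
pose f := mklinear mul_lin; apply: contrapT => no; apply: J_nfg.
apply: (fg_pred_ext (f := f)) => //.
- apply: contrapT => nfg; apply: no; right; apply: J_min nfg _.
  + split=> [|c _ _ [x Jx <-] [y Jy <-]]; first by exists 0; rewrite ?linear0.
    by exists (c *: x + y); rewrite ?linearP //; exact: JL.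
  + by move=> _ [x Jx <-]; exact: (linclosedZ (V := k^o)).
- apply: contrapT => nfg; apply: no; left => x Jx.
  suff [] : J x /\ f x = 0 by [].
  apply: J_min nfg _ _ Jx => [|y []//].
  split=> [|c y z [Jy fy] [Jz fz]]; first by rewrite linear0.
  by rewrite linearP fy fz scaler0 addr0; split=> //; exact: JL.
Qed.

(** The ideals generated by powers of [c] become stationary, so [c ^+ n = w * c ^+ n.+1] for some
    [n], and every element of [J] has the form [c ^+ n * y]. *)
Lemma minimal_inverse (J : k^o -> Prop) c : linclosed J ->
  (forall y, J y -> exists2 x, J x & c * x = y) ->
  exists w, forall x, J x -> w * c * x = x.
Proof.
move=> J_lin cJ.
have [||n nE] := @artinian_dcc (fun n x => exists w : k, x = w * c ^+ n).
- move=> n; split=> [|a _ _ [w ->] [w' ->]]; first by exists 0; rewrite mul0r.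
  by exists (a * w + w'); rewrite mulrDl -mulrA.
- by move=> n _ [w ->]; exists (w * c); rewrite exprS mulrA.
have [|w wE] := nE (c ^+ n); first by exists 1; rewrite mul1r.
exists w => x Jx; have [y Jy <-] : exists2 y, J y & c ^+ n * y = x.
  elim: n {nE wE} x Jx => [|n IHn] x Jx; first by exists x; rewrite ?mul1r.
  have [y Jy <-] := cJ x Jx; have [z Jz <-] := IHn y Jy.
  by exists z => //; rewrite exprS mulrA.
by rewrite [in RHS]wE exprS !mulrA.
Qed.

(* A minimal ideal [J] that is not finitely generated is a vector space over the
   field [k / ann J]; an infinite linearly independent sequence [v] in it would give
   the strictly decreasing chain of the spans of [v n, v n.+1, ...]. *)
Lemma artinian_noetherian (I : k^o -> Prop) : linclosed I -> fg_pred I.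
Proof.
move=> I_lin; apply: contrapT => I_nfg.
have [J [J_lin J_nfg J_min]] := artinian_minimal (C := fun I => ~ fg_pred I) I_lin I_nfg.
have cJ := minimal_mul J_lin J_nfg J_min.
(* Otherwise [s] would lie in [J] and generate it. *)
have next (s : seq k^o) : exists x, (forall y, y \in s -> J y) -> J x /\ ~ span s x.
  apply: contrapT => no_x; apply: J_nfg; exists s; split.
    by move=> y ys; apply: contrapT => nJy; apply: no_x; exists 0 => /(_ y ys).
  move=> x Jx; apply: contrapT => nsx; apply: no_x; exists x => _.
  by split.
have [h hP] := choice next.
pose L := fix L n := if n is m.+1 then h (L m) :: L m else [::].
have JL n y : y \in L n -> J y.
  elim: n y => // n IHn y; rewrite inE => /predU1P[->|/IHn //].
  exact: (hP (L n) IHn).1.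
pose v n := h (L n).
have Jv n : J (v n) := (hP (L n) (JL n)).1.
have nspan n : ~ span (L n) (v n) := (hP (L n) (JL n)).2.
have Lv n m : (n < m)%N -> v n \in L m.
  elim: m => // m IHm; rewrite ltnS leq_eqVlt => /predU1P[->|/IHm nm].
    exact: mem_head.
  by rewrite inE nm orbT.
(* The ideal generated by a tail of [v], as an intersection. Below, [M m] lists [v n.+1] up to
   [v (n + m)], to extract a finite combination. *)
pose W n x := forall P : k^o -> Prop, linclosed P ->
  (forall i, (n <= i)%N -> P (v i)) -> P x.
have [||n nE] := @artinian_dcc W.
- move=> n; split=> [P [] //|a x y Wx Wy P P_lin Pv].
  by apply: P_lin.2; [exact: Wx | exact: Wy].
- by move=> n x Wx P P_lin Pv; apply: Wx => // i /ltnW; exact: Pv.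
pose M := fix M m := if m is p.+1 then v (n.+1 + p)%N :: M p else [::].
have M_mono p q x : (p <= q)%N -> span (M p) x -> span (M q) x.
  move=> pq; apply: span_sub; elim: q pq => [|q IHq].
    by rewrite leqn0 => /eqP->.
  rewrite leq_eqVlt => /predU1P[-> //|/IHq sub y /sub yq].
  by rewrite inE yq orbT.
have [|||m] := nE (v n) _ (fun x => exists m, span (M m) x).
- by move=> P _ Pv; exact: Pv.
- split=> [|a x y [p px] [q qy]]; first by exists 0.
  exists (maxn p q); apply: (span_linclosed _).2.
    by apply: M_mono px; exact: leq_maxl.
  by apply: M_mono qy; exact: leq_maxr.
- move=> i ni; exists (i - n.+1).+1; apply: span_mem.
  by rewrite /= subnKC // mem_head.
elim: m => [v0|m IHm [a [y [My vE]]]].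
  by apply: (nspan n); rewrite v0; exact: (span_linclosed _).1.
(* Either [a] kills [J] and the last term drops out, or [a] is invertible on [J] and [v (n.+1 + m)]
   lies in the span of its predecessors. *)
have [a0|aJ] := cJ a.
  by apply: IHm; rewrite vE [a *: _]a0 ?add0r.
have [w wE] := minimal_inverse J_lin aJ.
apply: (nspan (n.+1 + m)%N).
have -> : v (n.+1 + m)%N = w *: (v n - y).
  by rewrite vE addrK scalerA; symmetry; exact: wE.
apply: linclosedZ (span_linclosed _) _; apply: linclosedB (span_linclosed _) _ _.
  by apply: span_mem; apply: Lv; rewrite addSn ltnS leq_addr.
apply: span_sub My => z; elim: m {IHm vE} => // m IHm.
rewrite inE => /predU1P[->|zM].
  by apply: Lv; rewrite addnS.
by rewrite addnS inE (IHm zM) orbT.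
Qed.

End Artinian.

(** * Submodules of finitely generated modules *)

Section NoetherianModules.
Variable k : nzRingType.
Hypothesis k_noeth : forall I : k^o -> Prop, linclosed I -> fg_pred I.

(** [I] is the ideal of possible coefficients at [v]; subtracting lifts of its generators reduces an
    element of [P] to the part in [span s]. *)
Lemma fg_pred_span (V : lmodType k) (s : seq V) (P : V -> Prop) :
  linclosed P -> (forall x, P x -> span s x) -> fg_pred P.
Proof.
elim: s P => [|v s IHs] P P_lin sP.
  by exists [::]; split=> // x /sP.
have [P0 PL] := P_lin; have [s0 sL] := span_linclosed s.
pose I (c : k^o) := exists2 x, P x & span s (x - c *: v).
have I_lin : linclosed I.
  split=> [|a c c' [x Px sx] [y Py sy]]; first by exists 0; rewrite // scale0r subrr.
  exists (a *: x + y); first exact: PL.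
  suff -> : a *: x + y - (a *: c + c' : k^o) *: v = a *: (x - c *: v) + (y - c' *: v).
    exact: sL.
  by rewrite scalerBr scalerDl scalerA opprD addrACA.
have [l [lI lE]] := k_noeth I_lin.
have [|t [tP tE]] := IHs (fun x => P x /\ span s x) _ (fun x => @proj2 _ _).
  split=> [|a x y [Px sx] [Py sy]]; first by [].
  by split; [exact: PL | exact: sL].
have [w wP wE] : exists2 w, (forall x, x \in w -> P x) &
    forall c, span l c -> exists2 x, span w x & span s (x - c *: v).
  elim: l lI {lE} => [_|c l IHl lI].
    by exists [::] => // c ->; exists 0; rewrite // scale0r subrr.
  have [|w wP wE] := IHl; first by move=> z zl; apply: lI; rewrite inE zl orbT.
  have [x Px sx] := lI c (mem_head _ _).
  exists (x :: w) => [z|_ [a [c' [/wE[y wy sy] ->]]]].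
    by rewrite inE => /predU1P[->|/wP].
  exists (a *: x + y); first by exists a, y.
  suff -> : a *: x + y - (a *: c + c' : k^o) *: v = a *: (x - c *: v) + (y - c' *: v).
    exact: sL.
  by rewrite scalerBr scalerDl scalerA opprD addrACA.
exists (w ++ t); split=> [x|x Px].
  by rewrite mem_cat => /orP[/wP|/tP[]].
have [a [z [sz xE]]] := sP x Px.
have [y wy sy] : exists2 y, span w y & span s (y - a *: v).
  by apply/wE/lE; exists x => //; rewrite xE addrAC subrr add0r.
rewrite -[x](subrK y) -[x - y]scale1r; apply: (span_linclosed _).2.
- apply: (@span_sub _ _ t) => [u ut|]; first by rewrite mem_cat ut orbT.
  apply: tE; split; first by apply: linclosedB => //; exact: (span_min P_lin wP).
  have -> : x - y = z - (y - a *: v) by rewrite xE opprB addrA [z + _]addrC.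
  exact: linclosedB.
- by apply: (@span_sub _ _ w) wy => u uw; rewrite mem_cat uw.
Qed.

End NoetherianModules.

(** * Restriction of scalars to the base ring *)

Section Restriction.
Variables (k A : nzRingType) (phi : k -> A).
Hypotheses (phi1 : phi 1 = 1) (phiM : forall b c, phi b * phi c = phi (b * c)).
Hypothesis phiD : {morph phi : b c / b + c}.

Section Restr.
Variable V : lmodType A.
(* The proof arguments let the scalar action on the alias be inferred from its type. *)
Definition restr of (phi 1 = 1) & (forall b c, phi b * phi c = phi (b * c)) &
  {morph phi : b c / b + c} : Type := V.
Notation rV := (restr phi1 phiM phiD).
HB.instance Definition _ := GRing.Zmodule.on rV.

Definition restr_scale (c : k) (v : rV) : rV := phi c *: (v : V).

Lemma restr_scaleA b c v : restr_scale b (restr_scale c v) = restr_scale (b * c) v.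
Proof. by rewrite /restr_scale scalerA phiM. Qed.
Lemma restr_scale1 : left_id 1 restr_scale.
Proof. by move=> v; rewrite /restr_scale phi1 scale1r. Qed.
Lemma restr_scaleDr : right_distributive restr_scale +%R.
Proof. by move=> a v w; exact: scalerDr. Qed.
Lemma restr_scaleDl v : {morph restr_scale^~ v : a b / a + b}.
Proof. by move=> a b; rewrite /restr_scale phiD scalerDl. Qed.

HB.instance Definition _ := GRing.Zmodule_isLmodule.Build k rV
  restr_scaleA restr_scale1 restr_scaleDr restr_scaleDl.

Definition restr_mod : lmodType k := rV.
End Restr.

Definition finite_over := exists s : seq A, forall a, @span k (restr_mod A^o) s a.

Hypothesis k_noeth : forall I : k^o -> Prop, linclosed I -> fg_pred I.
Hypothesis A_fin : finite_over.

Lemma span_restr (V : lmodType A) (t : seq V) :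
  exists u : seq V, forall x, span t x -> @span k (restr_mod V) u x.
Proof.
have [s sE] := A_fin; elim: t => [|v t [u uE]]; first by exists [::].
have v_lin : linear (fun a : restr_mod A^o => (a : A) *: v : restr_mod V).
  by move=> c a b; rewrite scalerDl -scalerA.
exists (map (mklinear v_lin) s ++ u) => _ [a [y [/uE uy ->]]].
rewrite -[_ *: v](@scale1r k (restr_mod V)).
apply: (@span_linclosed k (restr_mod V) _).2.
- apply: (@span_sub k (restr_mod V) (map (mklinear v_lin) s)).
    by move=> z zs; rewrite mem_cat zs.
  exact: (span_map (mklinear v_lin) (sE a)).
- by apply: (@span_sub k (restr_mod V) u) uy => z zs; rewrite mem_cat zs orbT.
Qed.

(** A submodule over [A] is one over [k] through [phi], and its generators over [k] also generate it
    over [A]. *)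
Lemma fg_submod_pred (V : lmodType A) (P : V -> Prop) :
  fg_module V -> linclosed P -> fg_pred P.
Proof.
move=> /fg_module_span[t tE] [P0 PL]; have [u uE] := span_restr t.
have [||w [wP wE]] := fg_pred_span (V := restr_mod V) (s := u) (P := P) k_noeth.
- by split=> // c x y; exact: PL.
- by move=> x _; exact: uE.
exists w; split=> // x /wE; elim: w {wP wE} x => // v w IHw x [c [y [wy ->]]].
by exists (phi c), y; split=> //; exact: IHw.
Qed.

End Restriction.

Definition noetherian (A : nzRingType) := forall (V : lmodType A) (P : V -> Prop),
  fg_module V -> linclosed P -> fg_pred P.

Lemma artin_algebra_noetherian (k : comNzRingType) (L : algType k) :
  artin_algebra L -> noetherian L.
Proof.
move=> [k_art /fg_module_span[s sE]] V P fgV P_lin.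
have phi1 : (1 : k)%:A = 1 :> L by rewrite scale1r.
have phiM (b c : k) : b%:A * c%:A = (b * c)%:A :> L by rewrite mulr_algl scalerA.
have phiD : {morph (fun c : k => c%:A : L) : b c / b + c} by move=> b c; rewrite scalerDl.
apply: (@fg_submod_pred k L (fun c => c%:A) phi1 phiM phiD (artinian_noetherian k_art) _ V P fgV P_lin).
exists s => a; elim: s a {sE} (sE a) => // v s IHs _ [c [y [/IHs sy ->]]].
by exists c, y; split=> //; rewrite -mulr_algl.
Qed.

Lemma artin_algebra_conv_noetherian (k : comNzRingType) (L : algType k) :
  artin_algebra L -> noetherian L^c.
Proof.
move=> [k_art /fg_module_span[s sE]] V P fgV P_lin.
pose phi (c : k) : L^c := (c%:A : L).
have phi1 : phi 1 = 1 by rewrite /phi scale1r.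
have phiM b c : phi b * phi c = phi (b * c).
  by rewrite -[LHS]/(c%:A * b%:A : L) mulr_algl scalerA mulrC.
have phiD : {morph phi : b c / b + c} by move=> b c; rewrite /phi scalerDl.
apply: (@fg_submod_pred k L^c phi phi1 phiM phiD (artinian_noetherian k_art) _ V P fgV P_lin).
exists s => a; elim: s a {sE} (sE a) => // v s IHs _ [c [y [/IHs sy ->]]].
by exists c, y; split=> //; rewrite -mulr_algr.
Qed.

Section NoetherianRing.
Variables (A : nzRingType) (A_noeth : noetherian A).

Lemma fg_submod (V : lmodType A) (S : submod V) :
  fg_module V -> fg_module (submod_sort S).
Proof.
move=> fgV; have [|s [sS sE]] := A_noeth (P := fun x => x \in S) fgV.
  by split=> [|a x y xS yS]; rewrite ?rpred0 // rpredD ?rpredZ.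
have [|t _ tE] := seq_lift (f := submod_incl S) (P := fun=> True) (s := s).
  by move=> y /sS/submod_exists[x xE]; exists x.
apply/fg_module_span; exists t => x.
have := sE _ (submodP x); rewrite -tE => /span_map_exists[y ty].
by move/submod_incl_inj <-.
Qed.

Lemma fg_inj (V W : lmodType A) (f : {linear V -> W}) :
  injective f -> fg_module W -> fg_module V.
Proof.
move=> f_inj fgW; have [|h hE] := factor_inj (e := f) (f := submod_incl (imm f)) f_inj.
  by move=> z; have /immP[y yE] := submodP z; exists y.
apply: (fg_surj (f := h)) (fg_submod _ fgW) => x.
have [|y yE] := @submod_exists _ _ (imm f) (f x); first by apply/immP; exists x.
by exists y; apply: f_inj; rewrite hE.
Qed.

Lemma fg_sum (V W : lmodType A) m (i : 'I_m -> {linear V -> W}) :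
  (forall y, exists x, \sum_j i j (x j) = y) -> fg_module V -> fg_module W.
Proof.
move=> i_surj /fg_module_span[s sE]; apply/fg_module_span.
pose t := flatten [seq map (i j) s | j <- enum 'I_m]; exists t => y.
have [x <-] := i_surj y; have [t0 tL] := span_linclosed t.
elim/big_ind: _ => // [u v tu tv|j _]; first by rewrite -[u]scale1r; exact: tL.
apply: span_sub (span_map (i j) (sE (x j))) => z zs.
by apply/flattenP; exists (map (i j) s) => //; apply: map_f; rewrite mem_enum.
Qed.

Lemma fg_row n : fg_module 'rV[A]_n.
Proof.
apply/fg_module_span; exists [seq delta_mx 0 i | i <- enum 'I_n] => r.
have [t0 tL] := span_linclosed [seq delta_mx 0 i | i <- enum 'I_n] (V := 'rV[A]_n).
rewrite (row_sum_delta r); elim/big_ind: _ => // [u v tu tv|i _].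
  by rewrite -[u]scale1r; exact: tL.
by apply: linclosedZ => //; apply: span_mem; apply: map_f; rewrite mem_enum.
Qed.

Lemma noetherian_cover (M : lmodType A) : fg_module M ->
  exists n (K : lmodType A) (i : {linear K -> 'rV[A]_n}) (p : {linear 'rV[A]_n -> M}),
    ses i p /\ fg_module K.
Proof.
move=> [s sE].
have p_lin : linear (fun r : 'rV[A]_(size s) => \sum_i r 0 i *: s`_i).
  move=> a r r'; rewrite scaler_sumr -big_split; apply: eq_bigr => i _.
  by rewrite !mxE scalerDl scalerA.
exists (size s), (submod_sort (kerm (mklinear p_lin))), (submod_incl _), (mklinear p_lin).
split; last exact: fg_submod (fg_row _).
apply: ses_kerm => x; have [c ->] := sE x.
exists (\row_i c i); apply: eq_bigr => i _; by rewrite mxE.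
Qed.

End NoetherianRing.

(** * Finite generation of Ext *)

Section FinitelyGeneratedExt.
Variables (A B : nzRingType) (U : bimod A B).
Hypotheses (A_noeth : noetherian A) (B_noeth : noetherian B).
Hypothesis fgU' : fg_module (flip U).
Variables (E : nat -> lmodType A) (e : {linear U -> E 0%N}).
Variable d : forall n, {linear E n -> E n.+1}.
Hypothesis res_U : injective_resolution e d.

(** The dual of [M] embeds in that of a free module, a finite sum of copies of [U]. *)
Lemma fg_Hom M : fg_module M -> fg_module (Hom U M).
Proof.
move=> /(noetherian_cover A_noeth)[n [K [i [p [[_ p_surj _] _]]]]].
apply: (fg_inj B_noeth (f := precomp U p)).
  move=> f h fh; apply: Hom_eq => x; have [y <-] := p_surj x.
  exact: (congr1 (fun w : Hom U _ => w y) fh).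
apply: (fg_sum (i := row_dual U (n := n))) fgU' => f.
by exists (fun j => row_coord U j f); exact: row_dual_coord.
Qed.

Lemma fg_Ext n M : fg_module M -> fg_module (Ext U n M).
Proof.
case: n => [|n]; first exact: fg_Hom.
(* Dimension shifting changes [M] but not [Q], which in degree 1 is a quotient of the dual of
   [K]. *)
move: (Ext U n.+1 M) (is_ext1_Ext U n M) => Q.
elim: n M => [|n IHn] M extQ fgM.
all: have [m [K [i [p [ip fgK]]]]] := noetherian_cover A_noeth fgM.
all: have P_lifts l : lifts d l 'rV[A]_m by
  apply: (lifts_projective res_U); exact: row_projective.
- have P0 : ext0 'rV[A]_m U by apply/(ext0_lifts0 res_U).
  have [q q_surj _] := coker_ext1 ip P0 extQ.
  exact: fg_surj q_surj (fg_Hom fgK).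
- exact: IHn (is_ext1_shift res_U ip P_lifts extQ) fgK.
Qed.

End FinitelyGeneratedExt.

(** * The equivalence of the four conditions *)

Theorem theorem4p4 (k k' : comNzRingType)
  (Lambda : algType k) (Gamma : algType k')
  (hLambda : artin_algebra Lambda) (hGamma : artin_algebra Gamma)
  (U : bimod Lambda Gamma^c)
  (hUl : fg_module U) (hUr : fg_module (flip U))
  (hbal : faithfully_balanced U) (hself : selforthogonal U)
  (hgor : gorenstein_bimodule U)
  (g : nat) (hidr : injdim_eq (flip U) g) (hidl : injdim_eq U g)
  (E : nat -> lmodType Lambda) (e : {linear U -> E 0%N})
  (d : forall n, {linear E n -> E n.+1})
  (hE : minimal_injective_resolution e d)
  (M : lmodType Lambda) (hM : fg_module M) (hM0 : ~ zero_module M) :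
  [<-> in_H U g M;
       iso_module M (Ext (flip U) g (Ext U g M));
       exists N : lmodType Gamma^c, fg_module N /\ iso_module M (Ext (flip U) g N);
       forall f : {linear M -> dsum E g}, forall x, f x = 0].
Proof.
have A_noeth := artin_algebra_noetherian hLambda.
have B_noeth := artin_algebra_conv_noetherian hGamma.
have [[E' [e' [d' [res_U' E'0]]]] _] := hidr.
have [res_U _ _] := hE.
have self_U' n : lifts d' n (flip U).
  by apply/(zero_Ext_lifts res_U'); case: (hself n.+1).
have injdim_U' n (X : lmodType Gamma^c) : (g <= n)%N -> lifts d' n X.
  by move=> gn; apply: lifts_zero; exact: E'0.
have Ext_iso (M' : lmodType Lambda) : fg_module M' ->
    (forall n, n <> g -> zero_module (Ext U n M')) ->
    iso_module M' (Ext (flip U) g (Ext U g M')).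
  exact: (Ext_Ext_iso res_U res_U' hbal self_U' (@noetherian_cover _ A_noeth) injdim_U').
tfae.
- by move=> [_ _ ext0M]; exact: Ext_iso.
- move=> isoM; exists (Ext U g M); split=> //.
  exact: (fg_Ext A_noeth B_noeth hUr res_U).
(* For [g = 0] the direct sum is empty; the Gorenstein condition starts in degree 1. *)
- move=> [N [fgN [j j_bij]]]; case: (posnP g) => [g0|g_gt0].
    by move=> f x; clear -g0; move: (f x); rewrite g0 => y; apply/rowP => -[].
  apply/dsum_zero; apply: (grade_zero_maps hE (W := Ext (flip U) g N)).
    exact: hgor.1.
  exact: bij_inj j_bij.
- move=> /dsum_zero ME.
  have extM n : n <> g -> zero_module (Ext U n M).
    move=> /eqP; rewrite neq_ltn => /orP[ng|].
      by apply: (lifts_zero_maps res_U) => f; exact: ME.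
    (* Vanishing above [g] is read off the finite resolution supplied by [hidl]. *)
    have [[F [u [v [res_F F0]]]] _] := hidl.
    case: n => // n gn; apply/(zero_Ext_lifts res_F).
    by apply: lifts_zero; exact: F0.
  split=> //; split=> [n ng|gradeM]; first by apply: extM => ngE; rewrite ngE ltnn in ng.
  (* If Ext^g(M, U) vanished too, [M] would be isomorphic to Ext^g of a zero module. *)
  apply: hM0; have [i i_bij] := Ext_iso M hM extM.
  have Y0 : zero_module (Ext U g M) by exact: gradeM (leqnn _).
  have W0 : zero_module (Ext (flip U) g (Ext U g M)).
    by apply: (lifts_zero_maps res_U') => f y; rewrite (Y0 y) linear0.
  by move=> x; apply: (bij_inj i_bij); rewrite linear0; exact: W0.
Qed.
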